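(* Let $c\ge2$ be an integer and let $\mathcal{P}_c$ be the set of primes not dividing $c$. For any $n\in\mathbb{N}$, the family $$\left(p^nL_{p,1}(n;\omega^{-n};1;c)\right)_{p\in\mathcal{P}_c}$$ is equal to $$\sum_{l=0}^\infty\ \sum_{\epsilon\in\mu_c\setminus\{1\}}\binom{-n}{l}(-1)^{1+l}\,\zeta_1(-l;\epsilon^{-1};1)\ \mathfrak{H}(n+l;\epsilon^{-1})^{\mathrm{Frob}^{-1}}.$$
   Context: $\mathbb{N}=\{1,2,\ldots\}$; $\mu_c$ is the group of $c$-th roots of unity in $\overline{\mathbb{Q}}$, regarded in $\mathbb{C}$ and, for each $p\in\mathcal{P}_c$, in $\mathbb{C}_p$ via fixed embeddings; $\mathbb{Q}(\mu_c)$ acts diagonally on $\prod_{p\in\mathcal{P}_c}\mathbb{Q}_p(\mu_c)$. $\binom{-n}{l}$ is the generalized binomial coefficient. The equality takes place in $\prod_{p\in\mathcal{P}_c}\mathbb{Q}_p(\mu_c)$, the series over $l$ being taken with respect to the topology of uniform convergence in $p\in\mathcal{P}_c$. $p$-adic $L$-function: for $p\nmid c$, let $\omega$ be the Teichmüller character on $\mathcal{O}_{\mathbb{C}_p}^\times$ and $\langle x\rangle=x/\omega(x)$. For $z\in\mathbb{P}^1(\mathbb{C}_p)$ with $|z-1|_p\ge1$ let $\mathfrak{m}_z$ be the measure on $\mathbb{Z}_p$ with $\mathfrak{m}_z(j+p^N\mathbb{Z}_p)=\frac{z^j}{1-z^{p^N}}$ for $0\le j\le p^N-1$, with $\int_{\mathbb{Z}_p}f\,d\mathfrak{m}_z=\lim_{N\to\infty}\sum_{a=0}^{p^N-1}f(a)\mathfrak{m}_z(a+p^N\mathbb{Z}_p)$.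 Put $\tilde{\mathfrak{m}}_c=\sum_{\xi^c=1,\ \xi\ne1}\mathfrak{m}_\xi$. For integers $s,k$, $$L_{p,1}(s;\omega^k;1;c)=\int_{\mathbb{Z}_p^\times}\langle x\rangle^{-s}\omega^k(x)\,d\tilde{\mathfrak{m}}_c(x).$$ Complex zeta function: for a root of unity $\xi\ne1$, $\zeta_1(s;\xi;1)=\sum_{m\ge1}\xi^m m^{-s}$ (absolutely convergent for $\Re s>1$), extended by analytic continuation to an entire function of $s$; its values at non-positive integers lie in $\mathbb{Q}(\xi)$. Cyclotomic multiple harmonic values (depth 1): for $n\in\mathbb{N}$, $\epsilon\in\mu_c$, $H_m(n;\epsilon)=\sum_{0<m_1<m}\frac{(1/\epsilon)^{m_1}}{m_1^n}$ and $\mathfrak{H}(n;\epsilon)=\left(p^nH_p(n;\epsilon)\right)_{p\in\mathcal{P}_c}\in\prod_{p\in\mathcal{P}_c}\mathbb{Q}_p(\mu_c)$. For $(x_p)_p\in\prod_p\mathbb{Q}_p(\mu_c)$, $(x_p)_p^{\mathrm{Frob}^{-1}}=(\mathrm{Frob}_p^{-1}(x_p))_p$, where $\mathrm{Frob}_p$ is the $\mathbb{Q}_p$-automorphism of $\mathbb{Q}_p(\mu_c)$ with $\xi\mapsto\xi^p$ for $\xi\in\mu_c$. *)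

(* Defs.v *)
From HB Require Import structures.
From mathcomp Require Import all_boot all_order all_algebra all_field.
From mathcomp Require Import complex.
From mathcomp Require Import all_classical all_reals all_analysis.

Set Implicit Arguments.
Unset Strict Implicit.
Unset Printing Implicit Defensive.

Import Order.TTheory GRing.Theory Num.Theory.
Import numFieldNormedType.Exports.

Local Open Scope classical_set_scope.
Local Open Scope complex_scope.
Local Open Scope ring_scope.

(* The norm of the library's normed modules cannot serve as a p-adic absolute
   value, because it satisfies |x *+ n| = |x| *+ n; hence the following notions
   for a field K with an arbitrary function abs : K -> R. *)

Definition abs_cvg (R : realType) (K : fieldType) (abs : K -> R)
    (u : nat -> K) (l : K) : Prop :=
  (fun N => abs (u N - l)) @ \oo --> (0 : R).

Definition abs_cauchy (R : realType) (K : fieldType) (abs : K -> R)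
    (u : nat -> K) : Prop :=
  forall e : R, 0 < e -> exists N : nat, forall i j : nat,
    (N <= i)%N -> (N <= j)%N -> abs (u i - u j) < e.

Definition abs_closure (R : realType) (K : fieldType) (abs : K -> R)
    (A : set K) : set K :=
  [set x | forall e : R, 0 < e -> exists2 a, A a & abs (x - a) < e].

(* Q_p is the completion of Q, hence the closure of Q in any complete field
   whose absolute value extends the p-adic one. *)
Definition closure_rat (R : realType) (K : fieldType) (abs : K -> R) : set K :=
  abs_closure abs (range (@ratr K)).

(* C_p, characterised as the completion of an algebraic closure of Q_p: K is
   algebraically closed, so the elements of K that are algebraic over Q_p form
   an algebraic closure of Q_p. *)
Record Cp_field (R : realType) (p : nat) := CpField {
  Cp_sort :> closedFieldType;
  pabs : Cp_sort -> R;
  pabs_ge0 : forall x, 0 <= pabs x;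
  pabs_eq0 : forall x, (pabs x == 0) = (x == 0);
  pabsM : forall x y, pabs (x * y) = pabs x * pabs y;
  pabsD : forall x y, pabs (x + y) <= Num.max (pabs x) (pabs y);
  pabs_p : pabs p%:R = p%:R^-1;
  Cp_complete : forall u, abs_cauchy pabs u -> exists l, abs_cvg pabs u l;
  Cp_algebraic_dense :
    abs_closure pabs [set x | exists q : {poly Cp_sort},
      [/\ q != 0, forall i, closure_rat pabs q`_i & root q x]] = setT
}.
Arguments pabs {R p c} x : rename.

(* mu_c minus 1, in any field. *)
Definition mu_minus1 (F : fieldType) (c : nat) : set F :=
  [set xi | xi ^+ c = 1 /\ xi <> 1].

Definition harmonic_val (F : fieldType) (m n : nat) (eps : F) : F :=
  \sum_(1 <= m1 < m) eps^-1 ^+ m1 / m1%:R ^+ n.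

Definition gbinom (F : fieldType) (a : F) (l : nat) : F :=
  (\prod_(i < l) (a - i%:R)) / l`!%:R.

Section Padic.
Context {R : realType} {p : nat} {K : Cp_field R p}.
Implicit Types (x z : K) (s k : int) (c n N a : nat).

Definition Qp : set K := closure_rat pabs.

Definition Zp_units : set K := [set x | Qp x /\ pabs x = 1].

(* On the units of the ring of integers of C_p: the root of unity of order
   prime to p that is congruent to x modulo the maximal ideal. *)
Definition teichmuller x : K :=
  xget 0 [set w : K |
    (exists m : nat, [/\ (0 < m)%N, coprime m p & w ^+ m = 1]) /\
    pabs (x - w) < 1].

Definition angle x : K := x / teichmuller x.

(* A measure on Z_p is given by its values mu N a on the balls a + p^N Z_p,
   for 0 <= a < p^N. *)
Definition padic_int (mu : nat -> nat -> K) (f : K -> K) : K :=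
  xget 0 [set l | abs_cvg pabs (fun N => \sum_(a < p ^ N) f a%:R * mu N a) l].

Definition mz z N a : K := z ^+ a / (1 - z ^+ (p ^ N)).

Definition mc_tilde c N a : K :=
  \sum_(xi \in (mu_minus1 c : set K)) mz xi N a.

Definition Lp1 s k c : K :=
  padic_int (mc_tilde c)
    (fun x => \1_Zp_units x * (angle x ^ (- s) * teichmuller x ^ k)).

(* Q_p(mu_c), as the smallest subfield containing Q_p and mu_c. *)
Definition Qp_mu c : set K :=
  \bigcap_(S in [set S : set K | [/\ divring_closed [in S], Qp `<=` S &
                                     [set x | x ^+ c = 1] `<=` S]]) S.

Definition is_Frob c (phi : K -> K) : Prop :=
  [/\ set_bij (Qp_mu c) (Qp_mu c) phi,
      {in Qp_mu c &, {morph phi : x y / x + y}},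
      {in Qp_mu c &, {morph phi : x y / x * y}},
      (forall x, Qp x -> phi x = x) &
      (forall xi, xi ^+ c = 1 -> phi xi = xi ^+ p)].

Definition Frob_inv c (phi : K -> K) : K -> K := 'pinv_(fun=> 0) (Qp_mu c) phi.

(* The p-component of frak H(n; eps), for eps in C_p. *)
Definition frakH n (eps : K) : K := p%:R ^+ n * harmonic_val p n eps.

End Padic.

Section Complex.
Context {R : realType}.
Implicit Types (xi s : R[i]).

(* m ^ (- s) = exp (- s ln m), for m >= 1. *)
Definition npowN (m : nat) s : R[i] :=
  let: a +i* b := s in
  let r := expR (- (a * ln m%:R)) in
  (r * cos (b * ln m%:R)) +i* (- (r * sin (b * ln m%:R))).

Definition entire (f : R[i] -> R[i]) : Prop :=
  forall s, derivable (f : R[i]^o -> R[i]^o) s 1.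

Definition zeta1 xi : R[i] -> R[i] :=
  xget (fun=> 0) [set f | entire f /\
    forall s, 1 < complex.Re s ->
      [series xi ^+ m.+1 * npowN m.+1 s]_m @ \oo --> (f s : R[i]^o)].

End Complex.

(* algC plays the role of Qbar; this is the preimage in Qbar of an algebraic
   complex number. *)
Definition alg_of (R : realType) (iota : {rmorphism algC -> R[i]})
    (z : R[i]) : algC :=
  xget 0 [set a | iota a = z].

Definition primes_of (c : nat) := {p : nat | prime p && ~~ (p %| c)%N}.

(* Convergence of a sequence of families indexed by the primes not dividing c,
   uniformly in the prime. *)
Definition uniform_cvg (R : realType) (c : nat)
    (K : forall q : primes_of c, Cp_field R (val q))
    (u : nat -> forall q, K q) (l : forall q, K q) : Prop :=
  forall e : R, 0 < e -> exists N : nat, forall L : nat, (N <= L)%N ->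
    forall q, pabs (u L q - l q) < e.

(* Main.v *)
Require Import Defs.
From mathcomp Require Import all_boot all_order all_algebra all_field.
From mathcomp Require Import complex ring lra.
From mathcomp Require Import all_classical all_reals all_analysis.

Set Implicit Arguments.
Unset Strict Implicit.
Unset Printing Implicit Defensive.

Import Order.TTheory GRing.Theory Num.Theory.
Import numFieldNormedType.Exports.

Local Open Scope classical_set_scope.
Local Open Scope complex_scope.
Local Open Scope ring_scope.

(** The p-adic side.  Since <x> omega(x) = x on units, the integral defining
    L_{p,1}(n; omega^(-n); 1; c) is the limit over N of
      sum_{0 <= a < p^N, p not dividing a} a^(-n) xi^a / (1 - xi^(p^N)),
    summed over the roots of unity xi <> 1 of order dividing c.  Writing
    a = m + p b with 0 < m < p and expanding (m + p b)^(-n) by the binomial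
    series in p b / m separates the two variables: the sum over m is a
    harmonic sum in xi, and the sum over b is
      sum_{b < p^N} b^l z^b / (1 - z^(p^N)),   z = xi^p,
    which converges to the rational function geom_moment z l of z, the formal
    value of sum_{b >= 0} b^l z^b ([moment_approx_bound], [term_estimate]).
    Because |1 - z| = 1 when z <> 1 has order prime to p, all the quantities
    in sight are p-adic integers, and the l-th term carries the factor
    p^(n+l); so the error after L terms is at most p^(-L) <= 2^(-L), uniformly
    in p ([Lp1_series]).  The inverse Frobenius is accounted for by the
    substitution xi -> xi^p, which permutes the roots of unity
    ([Frob_inv_frakH], [series_termE]).  The value lies in Q_p(mu_c) because
    the terms are integral combinations of 1, zeta, .., zeta^(c-1) times
    powers of p, so that the coordinates converge in Q_p ([Qp_mu_lim]).

    The complex side.  It must be shown that zeta_1(-l; w; 1) is the value of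
    the polylogarithm Li_{-l}(w), an explicit rational function of w.  For
    existence of the continuation, J summations by parts replace
    sum w^m m^(-s) by a finite sum plus a multiple of
    sum w^m Delta^J(m^(-s)), which converges for Re s > 2 - J because
    Delta^J(x^(-s)) = O(x^(1 - Re s - J)) ([diff_logpow_bound]); at s = -l the
    remaining series vanishes as soon as J > l ([zeta1_neg]).  For uniqueness,
    an entire function vanishing on a disc vanishes everywhere
    ([entire_eq0_near]): if g vanishes near w and g(z) <> 0, the functions
      e(u) = g(u)/g(z) ((z - w)/(u - w))^k
    are entire, equal 1 at z and tend to 0 uniformly on a large square around
    w as k grows; this contradicts Goursat's theorem for (1 - e(u))/(u - z),
    whose integral along the square is close to 2 pi i ([cauchy_rect]).

    The two sides meet in the inversion Li_{-l}(1/z) = (-1)^(l+1)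
    sum_{b >= 0} b^l z^b of rational functions: geom_moment is defined by the
    left-hand side and [geom_moment_rec] shows that it satisfies the
    recurrence characteristic of the right-hand side. *)


(** * Goursat theorem for closed real one-forms *)

Section Real.
Variable R : realType.
Implicit Types (x y a b : R).

Lemma le_derive_increment (f g : R -> R) (a b M : R) : a <= b ->
  (forall x, a <= x <= b -> is_derive x 1 f (g x)) ->
  (forall x, a <= x <= b -> `|g x| <= M) -> `|f b - f a| <= M * (b - a).
Proof.
move=> ab df gM.
have [x xab ->] : exists2 c, c \in `[a, b]%R & f b - f a = g c * (b - a).
  apply: MVT_segment => //.
    by move=> x /andP[/ltW ax /ltW xb]; apply: df; rewrite ax xb.
  apply: derivable_within_continuous => x; rewrite in_itv /= => xab.
  by have := df x xab => -[].
by rewrite normrM (ger0_norm (_ : 0 <= b - a)) ?subr_ge0// ler_wpM2r ?subr_ge0// gM.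
Qed.

Lemma dist_le_itv (a r s t : R) : a <= s <= a + r -> a <= t <= a + r -> `|s - t| <= r.
Proof.
move=> /andP[s1 s2] /andP[t1 t2]; rewrite ler_norml; apply/andP; split; lra.
Qed.

Lemma derive_increment_gt0 (f g : R -> R) (a b : R) : a < b ->
  (forall x, a <= x <= b -> is_derive x 1 f (g x)) ->
  (forall x, a <= x <= b -> 0 < g x) -> 0 < f b - f a.
Proof.
move=> ab df gM.
have [x xab ->] : exists2 c, c \in `[a, b]%R & f b - f a = g c * (b - a).
  apply: MVT_segment => //; first exact: ltW.
    by move=> x /andP[/ltW ax /ltW xb]; apply: df; rewrite ax xb.
  apply: derivable_within_continuous => x; rewrite in_itv /= => xab.
  by have := df x xab => -[].
by rewrite mulr_gt0 ?subr_gt0// gM.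
Qed.

(** Line integrals below are differences of primitives, so this is the only
    place where integration theory enters. *)
Lemma continuous_primitive (f : R -> R) (a : R) : continuous f ->
  exists F : R -> R, forall x, a < x -> is_derive x 1 F (f x).
Proof.
move=> cf; pose F x := (\int[lebesgue_measure]_(t in `[a, x]) f t)%R.
exists F => x ax.
have xx1 : x < x + 1 by rewrite ltrDl.
have [] := @continuous_FTC1_closed R f a x (x + 1) xx1 _ ax (cf x).
  apply: continuous_compact_integrable; first exact: segment_compact.
  exact: continuous_subspaceT.
move=> dF <-; rewrite derive1E; exact: derivableP.
Qed.

Lemma half_pow_cvg (w e : R) : 0 < e -> exists n : nat, w / 2 ^+ n < e.
Proof.
move=> e0.
have := @cvg_geometric R w (2^-1) _; rewrite ger0_norm ?invr_ge0// invf_lt1// ltr1n.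
move=> /(_ isT)/cvgrPdist_lt/(_ e e0)[n _ /(_ n)]/= /(_ (leqnn _)).
rewrite sub0r normrN exprVn => h; exists n; exact: le_lt_trans (ler_norm _) h.
Qed.

(** Compactness of the rectangle in the form used by Goursat's argument: if P
    failed for the rectangle it would fail for one rectangle in each of a
    nested sequence of quarters, hence near the point to which these shrink.
    The index n stands for the rectangle with lower left corner (x, y) and
    sides w / 2^n and h / 2^n. *)
Lemma bisection2 (P : R -> R -> nat -> Prop) (a c w h : R) :
  0 <= w -> 0 <= h ->
  (forall x y n,
     let x' := x + w / 2 ^+ n.+1 in let y' := y + h / 2 ^+ n.+1 in
     P x y n.+1 -> P x' y n.+1 -> P x y' n.+1 -> P x' y' n.+1 -> P x y n) ->
  (forall x0 y0, a <= x0 <= a + w -> c <= y0 <= c + h ->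
     exists2 d, 0 < d & forall x y n, a <= x -> x + w / 2 ^+ n <= a + w ->
       c <= y -> y + h / 2 ^+ n <= c + h ->
       x <= x0 <= x + w / 2 ^+ n ->
       y <= y0 <= y + h / 2 ^+ n -> w / 2 ^+ n < d -> h / 2 ^+ n < d -> P x y n) ->
  P a c 0%N.
Proof.
move=> w0 h0 step loc; apply: contrapT => nP.
pose half (t u : R) n t' := t' = t \/ t' = t + u / 2 ^+ n.+1.
have /choice[nxt nxtP] : forall q : R * R * nat, exists r : R * R,
    ~ P q.1.1 q.1.2 q.2 ->
    [/\ ~ P r.1 r.2 q.2.+1, half q.1.1 w q.2 r.1 & half q.1.2 h q.2 r.2].
  move=> [[x y] n] /=.
  have [p|np] := pselect (P x y n); first by exists (x, y).
  have : ~ (P x y n.+1 /\ P (x + w / 2 ^+ n.+1) y n.+1 /\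
    P x (y + h / 2 ^+ n.+1) n.+1 /\ P (x + w / 2 ^+ n.+1) (y + h / 2 ^+ n.+1) n.+1).
    by move=> [? [? [? ?]]]; apply: np; exact: step.
  move=> /not_andP[q|/not_andP[q|/not_andP[q|q]]];
    [exists (x, y)|exists (x + w / 2 ^+ n.+1, y)
    |exists (x, y + h / 2 ^+ n.+1)|exists (x + w / 2 ^+ n.+1, y + h / 2 ^+ n.+1)];
    move=> _; split=> //=; by [left|right].
pose s := fix s n : R * R := if n is m.+1 then nxt (s m, m) else (a, c).
have sP n : ~ P (s n).1 (s n).2 n.
  by elim: n => //= n IH; have [] := nxtP (s n, n) IH.
have sx n : half (s n).1 w n (s n.+1).1 by have [] := nxtP (s n, n) (sP n).
have sy n : half (s n).2 h n (s n.+1).2 by have [] := nxtP (s n, n) (sP n).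
have key (u t0 : R) (t : nat -> R) : 0 <= u -> t 0%N = t0 -> (forall n, half (t n) u n (t n.+1)) ->
    exists2 T, t0 <= T <= t0 + u & forall n,
      [/\ t n <= T <= t n + u / 2 ^+ n, t0 <= t n & t n + u / 2 ^+ n <= t0 + u].
  move=> u0 t00 tS.
  have up n : 0 <= u / 2 ^+ n by rewrite divr_ge0 ?exprn_ge0.
  have uS n : u / 2 ^+ n = u / 2 ^+ n.+1 + u / 2 ^+ n.+1.
    rewrite exprS; field; by rewrite expf_neq0.
  have inc n : t n <= t n.+1 by case: (tS n) => ->//; rewrite lerDl.
  have dec n : t n.+1 + u / 2 ^+ n.+1 <= t n + u / 2 ^+ n.
    by rewrite [in leRHS]uS addrA lerD2r; case: (tS n) => ->//; rewrite lerDl.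
  have incm : {homo t : n m / (n <= m)%N >-> n <= m}.
    by apply: homo_leq => // ? ? ?; exact: le_trans.
  have decm n m : (n <= m)%N -> t m + u / 2 ^+ m <= t n + u / 2 ^+ n.
    move=> nm; rewrite -(subnK nm); elim: (m - n)%N => // k IH.
    exact: le_trans (dec _) IH.
  have ub n m : t m <= t n + u / 2 ^+ n.
    have [nm|/ltnW mn] := leqP n m.
      by apply: le_trans (decm _ _ nm); rewrite lerDl.
    by apply: le_trans (incm _ _ mn) _; rewrite lerDl.
  have hs : has_sup (range t).
    split; first by exists (t 0%N); exists 0%N.
    by exists (t 0%N + u / 2 ^+ 0) => _ [m _ <-]; exact: ub.
  have Tn n : t n <= sup (range t) <= t n + u / 2 ^+ n.
    apply/andP; split; first by apply: ub_le_sup; [case: hs|exists n].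
    by apply: ge_sup; [case: hs|move=> _ [m _ <-]; exact: ub].
  exists (sup (range t)).
    by have := Tn 0%N; rewrite expr0 divr1 t00.
  move=> n; split=> //; first by rewrite -t00; exact: incm.
  by have := decm 0%N n (leq0n _); rewrite expr0 divr1 t00.
have [X Xa Xn] := key w a (fun n => (s n).1) w0 erefl sx.
have [Y Yc Yn] := key h c (fun n => (s n).2) h0 erefl sy.
have [d d0 dP] := loc X Y Xa Yc.
have [n nd] := half_pow_cvg (w + h) d0.
have nn m : 0 < 2 ^+ m :> R by rewrite exprn_gt0.
have [x1 x2 x3] := Xn n; have [y1 y2 y3] := Yn n.
apply: (sP n); apply: dP => //.
  by apply: le_lt_trans nd; rewrite ler_pM2r ?invr_gt0// lerDl.
by apply: le_lt_trans nd; rewrite ler_pM2r ?invr_gt0// lerDr.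
Qed.

(** The integral of u dx + v dy along the boundary of [a,b] x [c,d], where U y
    and V x are primitives of u along the horizontal line at height y and of v
    along the vertical line at abscissa x. *)
Definition rect_integral (U V : R -> R -> R) (a b c d : R) : R :=
  (U c b - U c a) + (V b d - V b c) - (U d b - U d a) - (V a d - V a c).

(** Differentiability of u and v at (x, y) together with du/dy = dv/dx (the
    common value be). *)
Definition closed_form_at (u v : R -> R -> R) (x y : R) : Prop :=
  exists al be ga : R, forall e, 0 < e -> exists2 d, 0 < d &
    forall h k, `|h| < d -> `|k| < d ->
      `|u (x + h) (y + k) - u x y - al * h - be * k| <= e * (`|h| + `|k|) /\
      `|v (x + h) (y + k) - v x y - be * h - ga * k| <= e * (`|h| + `|k|).

(** Near a point, u dx + v dy differs from an affine closed form, whose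
    boundary integral vanishes, by a little-o; hence the integral over a small
    rectangle is at most epsilon times the square of its size.  This bound is
    compatible with cutting into quarters, so bisection propagates it to the
    whole rectangle.  Continuity of the partial derivatives is not assumed,
    which is essential because an entire function is only assumed to be
    differentiable. *)
Lemma goursat (u v U V : R -> R -> R) (a b c d : R) : a <= b -> c <= d ->
  (forall x y, a <= x <= b -> c <= y <= d -> is_derive x 1 (U y) (u x y)) ->
  (forall x y, a <= x <= b -> c <= y <= d -> is_derive y 1 (V x) (v x y)) ->
  (forall x y, a <= x <= b -> c <= y <= d -> closed_form_at u v x y) ->
  rect_integral U V a b c d = 0.
Proof.
move=> ab cd dU dV cl.
pose w := b - a; pose h := d - c.
have w0 : 0 <= w by rewrite subr_ge0.
have h0 : 0 <= h by rewrite subr_ge0.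
have awb : a + w = b by rewrite /w addrC subrK.
have chd : c + h = d by rewrite /h addrC subrK.
suff small K : 0 < K -> `|rect_integral U V a b c d| <= K.
  apply/normr0_eq0; apply/eqP; rewrite eq_le normr_ge0 andbT.
  by apply/ler_addgt0Pl => e e0; rewrite addr0; exact: small.
move=> K0.
pose P x y n := `|rect_integral U V x (x + w / 2 ^+ n) y (y + h / 2 ^+ n)| <= K / 4 ^+ n.
have -> : `|rect_integral U V a b c d| <= K = P a c 0%N.
  by rewrite /P !expr0 !divr1 awb chd.
apply: (@bisection2 P a c w h w0 h0).
  move=> x y n x' y'; rewrite /P.
  have e2 t : t / 2 ^+ n = t / 2 ^+ n.+1 + t / 2 ^+ n.+1 :> R.
    rewrite exprS; field; by rewrite expf_neq0.
  have e4 : K / 4 ^+ n = (K / 4 ^+ n.+1) *+ 4.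
    rewrite exprS -mulr_natr; field; by rewrite expf_neq0.
  rewrite (e2 w) (e2 h) e4 !addrA -/x' -/y'.
  set x'' := x' + _; set y'' := y' + _ => h1 h2 h3 h4.
  have -> : rect_integral U V x x'' y y'' = rect_integral U V x x' y y' + rect_integral U V x' x'' y y'
      + rect_integral U V x x' y' y'' + rect_integral U V x' x'' y' y''.
    by rewrite /rect_integral; ring.
  apply: le_trans (ler_normD _ _) _; rewrite mulrSr lerD//.
  apply: le_trans (ler_normD _ _) _; rewrite mulrSr lerD//.
  apply: le_trans (ler_normD _ _) _; rewrite mulr2n lerD//.
move=> x0 y0; rewrite awb chd => x0ab y0cd.
have [al [be [ga H]]] := cl x0 y0 x0ab y0cd.
pose e := K / (2 * (w + h + 1) ^+ 2).
have e0 : 0 < e by rewrite divr_gt0// mulr_gt0// exprn_gt0// ltr_wpDl// addr_ge0.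
have [dl dl0 {}H] := H e e0.
exists dl => // x y n ax xb cy yd xx0 yy0.
have n2 : 0 < 2 ^+ n :> R by rewrite exprn_gt0.
have wn0 : 0 <= w / 2 ^+ n by rewrite divr_ge0// ltW.
have hn0 : 0 <= h / 2 ^+ n by rewrite divr_ge0// ltW.
rewrite /P.
have Ke : 2 * e * (w / 2 ^+ n + h / 2 ^+ n) ^+ 2 <= K / 4 ^+ n.
  have -> : 2 * e * (w / 2 ^+ n + h / 2 ^+ n) ^+ 2 =
    K / 4 ^+ n * ((w + h) / (w + h + 1)) ^+ 2.
    rewrite /e (_ : 4 ^+ n = (2 ^+ n) ^+ 2); last first.
      by rewrite -exprM mulnC exprM; congr (_ ^+ n); ring.
    have n1 : w + h + 1 != 0 by rewrite lt0r_neq0// ltr_wpDl// addr_ge0.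
    by field; rewrite n1 lt0r_neq0.
  rewrite ler_piMr// ?divr_ge0// ?exprn_ge0//; first exact: ltW.
  have n0 : 0 <= w + h by rewrite addr_ge0.
  have n1 : 0 < w + h + 1 by rewrite ltr_wpDl.
  apply: exprn_ile1; first by apply: divr_ge0 => //; exact: ltW.
  by rewrite ler_pdivrMr// mul1r lerDl.
move: xb yd xx0 yy0 wn0 hn0 Ke; set w' := w / _; set h' := h / _.
move=> xb yd xx0 yy0 wn0 hn0 Ke wd hd; apply: le_trans Ke.
pose x1 := x + w'; pose y1 := y + h'.
(* subtracting the affine part does not change the integral *)
pose U' t s := U t s - (u x0 y0 * s + al * ((s - x0) ^+ 2 / 2) + be * (t - y0) * s).
pose V' s t := V s t - (v x0 y0 * t + be * (s - x0) * t + ga * ((t - y0) ^+ 2 / 2)).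
have -> : rect_integral U V x x1 y y1 = rect_integral U' V' x x1 y y1.
  by rewrite /rect_integral /U' /V'; field.
have dU' s t : x <= s <= x1 -> y <= t <= y1 ->
    is_derive s 1 (U' t) (u s t - u x0 y0 - al * (s - x0) - be * (t - y0)).
  move=> /andP[s1 s2] /andP[t1 t2].
  have dUs : is_derive s 1 (U t) (u s t).
    by apply: dU; rewrite ?(le_trans ax s1) ?(le_trans s2 xb) ?(le_trans cy t1) ?(le_trans t2 yd).
  rewrite /U'; apply: is_derive_eq; rewrite /GRing.scale /=; by field.
have dV' s t : x <= s <= x1 -> y <= t <= y1 ->
    is_derive t 1 (V' s) (v s t - v x0 y0 - be * (s - x0) - ga * (t - y0)).
  move=> /andP[s1 s2] /andP[t1 t2].
  have dVt : is_derive t 1 (V s) (v s t).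
    by apply: dV; rewrite ?(le_trans ax s1) ?(le_trans s2 xb) ?(le_trans cy t1) ?(le_trans t2 yd).
  rewrite /V'; apply: is_derive_eq; rewrite /GRing.scale /=; by field.
have bd s t : x <= s <= x1 -> y <= t <= y1 ->
    `|u s t - u x0 y0 - al * (s - x0) - be * (t - y0)| <= e * (w' + h') /\
    `|v s t - v x0 y0 - be * (s - x0) - ga * (t - y0)| <= e * (w' + h').
  move=> hs ht.
  have sw : `|s - x0| <= w' by exact: dist_le_itv hs xx0.
  have th : `|t - y0| <= h' by exact: dist_le_itv ht yy0.
  have := H (s - x0) (t - y0) (le_lt_trans sw wd) (le_lt_trans th hd).
  have -> : x0 + (s - x0) = s by ring.
  have -> : y0 + (t - y0) = t by ring.
  move=> [b1 b2]; split; [apply: le_trans b1 _|apply: le_trans b2 _];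
    by apply: ler_wpM2l; [exact: ltW|exact: lerD].
have xx1 : x <= x1 by rewrite lerDl.
have yy1 : y <= y1 by rewrite lerDl.
have bU t : y <= t <= y1 -> `|U' t x1 - U' t x| <= e * (w' + h') * w'.
  move=> ht.
  have {2}-> : w' = x1 - x by rewrite /x1 addrC addKr.
  by apply: le_derive_increment => // s hs; [exact: dU'|have [] := bd s t hs ht].
have bV s : x <= s <= x1 -> `|V' s y1 - V' s y| <= e * (w' + h') * h'.
  move=> hs.
  have {2}-> : h' = y1 - y by rewrite /y1 addrC addKr.
  by apply: le_derive_increment => // t ht; [exact: dV'|have [] := bd s t hs ht].
have {}H1 := bU y _; have {}H2 := bU y1 _; have H3 := bV x _; have H4 := bV x1 _.
rewrite !lexx ?xx1 ?yy1 /= in H1 H2 H3 H4.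
rewrite /rect_integral.
apply: le_trans (ler_normB _ _) _; apply: le_trans (lerD (ler_normB _ _) (lexx _)) _.
apply: le_trans (lerD (lerD (ler_normD _ _) (lexx _)) (lexx _)) _.
apply: le_trans (lerD (lerD (lerD (H1 isT) (H4 isT)) (H2 isT)) (H3 isT)) _.
by rewrite le_eqVlt; apply/orP; left; apply/eqP; ring.
Qed.

End Real.

(** * Complex differentiability with real-valued absolute value *)

Section Cx.
Variable R : realType.
Local Notation C := R[i].
Local Notation cabs := (@Normc.normc R).
Local Notation Re := (@complex.Re R).
Local Notation Im := (@complex.Im R).
Implicit Types (z s h w : C) (f g : C -> C).

Lemma cabs_norm z : `|z| = (cabs z)%:C. Proof. by []. Qed.
Lemma cabsM z w : cabs (z * w) = cabs z * cabs w. Proof. exact: Normc.normcM. Qed.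
Lemma cabsD z w : cabs (z + w) <= cabs z + cabs w. Proof. exact: le_normcD. Qed.
Lemma cabsN z : cabs (- z) = cabs z. Proof. exact: normcN. Qed.
Lemma cabsB z w : cabs (z - w) <= cabs z + cabs w.
Proof. by rewrite -(cabsN w); exact: cabsD. Qed.
Lemma cabs_distC z w : cabs (z - w) = cabs (w - z).
Proof. by rewrite -cabsN opprB. Qed.
Lemma cabsV z : cabs z^-1 = (cabs z)^-1. Proof. exact: Normc.normcV. Qed.
Lemma cabs_ge0 z : 0 <= cabs z.
Proof. by case: z => a b; exact: sqrtr_ge0. Qed.
Lemma cabs0 : cabs 0 = 0. Proof. exact: Normc.normc0. Qed.
Lemma cabs1 : cabs 1 = 1. Proof. exact: Normc.normc1. Qed.
Lemma cabs_eq0 z : (cabs z == 0) = (z == 0).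
Proof. by apply/eqP/eqP => [/Normc.eq0_normc|->]//; exact: cabs0. Qed.
Lemma cabs_gt0 z : (0 < cabs z) = (z != 0).
Proof. by rewrite lt0r cabs_eq0 cabs_ge0 andbT. Qed.
Lemma cabsX z n : cabs (z ^+ n) = cabs z ^+ n.
Proof. by elim: n => [|n IH]; rewrite ?expr0 ?cabs1// !exprS cabsM IH. Qed.
Lemma cabs_real (x : R) : cabs x%:C = `|x|.
Proof. by rewrite /Normc.normc /= expr0n addr0 sqrtr_sqr. Qed.
Lemma cabs_sqr z : cabs z ^+ 2 = Re z ^+ 2 + Im z ^+ 2.
Proof. by case: z => a b /=; rewrite sqr_sqrtr// addr_ge0// sqr_ge0. Qed.
Lemma Re_le_cabs z : `|Re z| <= cabs z.
Proof. by rewrite -(@ler_pXn2r R 2)// ?nnegrE ?cabs_ge0// cabs_sqr real_normK ?num_real// lerDl sqr_ge0. Qed.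
Lemma Im_le_cabs z : `|Im z| <= cabs z.
Proof. by rewrite -(@ler_pXn2r R 2)// ?nnegrE ?cabs_ge0// cabs_sqr real_normK ?num_real// lerDr sqr_ge0. Qed.
Lemma cabs_le_ReIm (x y : R) : cabs (x +i* y) <= `|x| + `|y|.
Proof.
rewrite -(@ler_pXn2r R 2)// ?nnegrE ?cabs_ge0 ?addr_ge0// cabs_sqr /= sqrrD.
by rewrite !real_normK ?num_real// lerD2r lerDl mulrn_wge0 ?mulr_ge0.
Qed.

(** Errors are measured by the real-valued modulus, since the norm of a
    complex number is itself a complex number. *)
Definition cdiff f s v := forall e : R, 0 < e -> exists2 d : R, 0 < d &
  forall h, cabs h < d -> cabs (f (s + h) - f s - v * h) <= e * cabs h.

Lemma derivable_cdiff f s : derivable (f : C^o -> C^o) s 1 -> exists v, cdiff f s v.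
Proof.
move=> /cvg_ex[/= v]; move=> fv; exists v => e e0.
have ec : 0 < e%:C by rewrite ltcR.
move/cvgrPdist_le : fv => /(_ _ ec).
rewrite near_withinE => /nbhs_ballP[d /= d0 Hd].
have dE : d = (Re d)%:C by move: d0; case: (d) => a b; rewrite ltcE /= => /andP[/eqP -> _].
exists (Re d) => [|h hd]; first by rewrite -ltcR -dE.
have [->|h0] := eqVneq h 0; first by rewrite addr0 subrr sub0r mulr0 cabsN cabs0 mulr0.
have := Hd h; rewrite /ball /= sub0r normrN cabs_norm dE ltcR => /(_ hd h0).
rewrite cabs_norm lecR => le.
have -> : f (s + h) - f s - v * h = - (h * (v - h^-1 *: (f (h *: 1 + s) - f s))).
  rewrite -[h *: 1]/(h * 1) mulr1 -[_ *: _]/(_ * _) (addrC h).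
  by field.
by rewrite cabsN cabsM mulrC ler_wpM2r// cabs_ge0.
Qed.

Lemma cdiff_derivable f s v : cdiff f s v -> derivable (f : C^o -> C^o) s 1.
Proof.
move=> fv; apply/cvg_ex; exists v; apply/cvgrPdist_le => e e0.
have eE : e = (Re e)%:C by move: e0; case: (e) => a b; rewrite ltcE /= => /andP[/eqP -> _].
have re0 : 0 < Re e by rewrite -ltcR -eE.
have [d d0 H] := fv _ re0.
rewrite near_withinE; apply/nbhs_ballP; exists d%:C => /=; first by rewrite ltcR.
move=> h; rewrite /ball /= sub0r normrN cabs_norm ltcR => hd h0.
rewrite eE cabs_norm lecR.
have -> : v - h^-1 *: (f (h *: 1 + s) - f s) = - (h^-1 * (f (s + h) - f s - v * h)).
  rewrite -[h *: 1]/(h * 1) mulr1 -[_ *: _]/(_ * _) (addrC h).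
  by field.
rewrite cabsN cabsM cabsV mulrC ler_pdivrMr ?cabs_gt0//; exact: H.
Qed.

Lemma cdiff_cont f s v : cdiff f s v -> forall e : R, 0 < e -> exists2 d : R, 0 < d &
  forall h, cabs h < d -> cabs (f (s + h) - f s) < e.
Proof.
move=> fv e e0; have [d d0 H] := fv 1 ltr01.
have M0 : 0 < 1 + cabs v by rewrite ltr_pwDl// cabs_ge0.
exists (Num.min d (e / (1 + cabs v))); first by rewrite lt_min d0 divr_gt0.
move=> h; rewrite lt_min => /andP[hd]; rewrite ltr_pdivlMr// => he.
apply: le_lt_trans he; rewrite -[X in cabs X <= _](subrK (v * h)).
rewrite mulrDr mulr1; apply: le_trans (cabsD _ _) _.
by rewrite cabsM (mulrC (cabs v)) lerD2r -[leRHS]mul1r; exact: H.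
Qed.

Let pt (x y : R) : C := x +i* y.

(** The Cauchy-Riemann equations: Im (f dz) = Im f dx + Re f dy is a closed
    form. *)
Lemma closed_of_cdiff f (x y : R) v : cdiff f (pt x y) v ->
  closed_form_at (fun x y => Im (f (pt x y))) (fun x y => Re (f (pt x y))) x y.
Proof.
move=> fv; exists (Im v), (Re v), (- Im v) => e e0.
have [d d0 H] := fv e e0; exists (d / 2); first by rewrite divr_gt0.
move=> h k hd kd.
have hk : cabs (pt h k) < d.
  by apply: le_lt_trans (cabs_le_ReIm _ _) _; rewrite (splitr d) ltrD.
have := H _ hk; rewrite (_ : pt x y + pt h k = pt (x + h) (y + k))//.
set D := f _ - _ - _ => HD.
have {}HD : cabs D <= e * (`|h| + `|k|).
  by apply: le_trans HD _; apply: ler_wpM2l; [exact: ltW|exact: cabs_le_ReIm].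
split.
  apply: le_trans HD; apply: le_trans (Im_le_cabs D); rewrite le_eqVlt.
  apply/orP; left; apply/eqP; congr (`|_|); rewrite /D.
  by case: (f _) => ? ?; case: (f _) => ? ?; case: (v) => ? ? /=; ring.
apply: le_trans HD; apply: le_trans (Re_le_cabs D); rewrite le_eqVlt.
apply/orP; left; apply/eqP; congr (`|_|); rewrite /D.
by case: (f _) => ? ?; case: (f _) => ? ?; case: (v) => ? ? /=; ring.
Qed.

Lemma continuous_line (g : C -> R) (F : C -> C) (z dz : C) :
  (forall s t, `|g s - g t| <= cabs (F s - F t)) ->
  (forall s e, 0 < e -> exists2 d : R, 0 < d & forall h, cabs h < d -> cabs (F (s + h) - F s) < e) ->
  cabs dz = 1 -> continuous (fun t : R => g (z + t%:C * dz)).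
Proof.
move=> gF cF dz1 t; apply/cvgrPdist_lt => e e0.
have [d d0 H] := cF (z + t%:C * dz) e e0.
apply/nbhs_ballP; exists d => // t' /=; rewrite /ball /= => tt'.
apply: le_lt_trans (gF _ _) _; rewrite cabs_distC.
have -> : z + t'%:C * dz = z + t%:C * dz + (t' - t)%:C * dz by rewrite rmorphB /=; ring.
by apply: H; rewrite cabsM dz1 mulr1 cabs_real distrC.
Qed.

End Cx.

(** * A Cauchy-type inequality on rectangles *)

Section Cx.
Variable R : realType.
Local Notation C := R[i].
Local Notation cabs := (@Normc.normc R).
Local Notation Re := (@complex.Re R).
Local Notation Im := (@complex.Im R).
Implicit Types (z s h w : C) (f g : C -> C).

Lemma cdiff_near f g s v (r : R) : 0 < r ->
  (forall h, cabs h < r -> g (s + h) = f (s + h)) -> cdiff f s v -> cdiff g s v.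
Proof.
move=> r0 gf fv e e0; have [d d0 H] := fv e e0.
exists (Num.min d r); first by rewrite lt_min d0 r0.
move=> h; rewrite lt_min => /andP[hd hr].
by rewrite gf// -[s in g s]addr0 gf ?cabs0// addr0; exact: H.
Qed.

Lemma continuous_Im_line (F : C -> C) (y : R) :
  (forall s e, 0 < e -> exists2 d : R, 0 < d & forall h, cabs h < d -> cabs (F (s + h) - F s) < e) ->
  continuous (fun x : R => Im (F (x +i* y))).
Proof.
move=> cF; have := @continuous_line R (fun z => Im (F z)) F (0 +i* y) 1 _ cF.
rewrite cabs1 => /(_ _ erefl); rewrite (_ : (fun _ => _) = (fun x : R => Im (F (x +i* y)))); last first.
  by apply/funext => x; congr (Im (F _)); rewrite mulr1; apply/eqP; rewrite eq_complex /= add0r addr0 !eqxx.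
apply => s t; have := Im_le_cabs (F s - F t).
by case: (F s) => ? ?; case: (F t).
Qed.

Lemma continuous_Re_line (F : C -> C) (x : R) :
  (forall s e, 0 < e -> exists2 d : R, 0 < d & forall h, cabs h < d -> cabs (F (s + h) - F s) < e) ->
  continuous (fun y : R => Re (F (x +i* y))).
Proof.
move=> cF; have := @continuous_line R (fun z => Re (F z)) F (x +i* 0) 'i _ cF.
rewrite (_ : cabs 'i = 1); last by rewrite /Normc.normc /= expr0n add0r expr1n sqrtr1.
move=> /(_ _ erefl); rewrite (_ : (fun _ => _) = (fun y : R => Re (F (x +i* y)))); last first.
  apply/funext => y; congr (Re (F _)); apply/eqP; rewrite eq_complex /=.
  by rewrite !(mulr0, mulr1, mul0r, subr0, addr0, add0r) !eqxx.
apply => s t; have := Re_le_cabs (F s - F t).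
by case: (F s) => ? ?; case: (F t).
Qed.

(** A perturbation of the imaginary part of w / z: this is how the integrand
    (1 - u) / z keeps the sign of 1 / z on the sides of a rectangle around 0. *)
Lemma Im_side w u z : z != 0 -> cabs w = 1 ->
  cabs u * cabs z < Im (w * z^*) -> 0 < Im (w * ((1 - u) * z^-1)).
Proof.
move=> z0 w1 h; have n0 : 0 < cabs z by rewrite cabs_gt0.
have -> : Im (w * ((1 - u) * z^-1)) = Im (w * z^*) / cabs z ^+ 2 - Im (w * (u * z^-1)).
  rewrite cabs_sqr; case: w z u {h w1 z0 n0} => [p q] [x y] [s t] /=; ring.
rewrite subr_gt0; apply: le_lt_trans (ler_norm _) _; apply: le_lt_trans (Im_le_cabs _) _.
rewrite !cabsM w1 mul1r cabsV ltr_pdivlMr ?exprn_gt0//; apply: le_lt_trans h.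
by rewrite expr2 mulrA divfK// gt_eqF.
Qed.

Lemma ImN z : Im (- z) = - Im z. Proof. by case: z. Qed.

Lemma Im_mulI z : Im ('i * z) = Re z.
Proof. by case: z => a b /=; rewrite mul0r mul1r add0r. Qed.

Lemma cabs_i : cabs 'i = 1.
Proof. by rewrite /Normc.normc /= expr0n add0r expr1n sqrtr1. Qed.

(** A weak form of the maximum principle: e cannot be 1 at z0 and small on the
    boundary of a rectangle around z0.  Otherwise Im ((1 - e(z)) / (z - z0)
    dz) would be positive along each of the four sides, whereas the integral
    of (1 - e(z)) / (z - z0), a function that is holomorphic except at z0 and
    continuous at z0, is 0. *)
Lemma cauchy_rect (e : C -> C) (a b c d x0 y0 : R) :
  a < x0 < b -> c < y0 < d ->
  (forall s, exists v, cdiff e s v) -> e (x0 +i* y0) = 1 ->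
  (forall x, a <= x <= b -> cabs (e (x +i* c)) * cabs ((x - x0) +i* (c - y0)) < y0 - c) ->
  (forall x, a <= x <= b -> cabs (e (x +i* d)) * cabs ((x - x0) +i* (d - y0)) < d - y0) ->
  (forall y, c <= y <= d -> cabs (e (a +i* y)) * cabs ((a - x0) +i* (y - y0)) < x0 - a) ->
  (forall y, c <= y <= d -> cabs (e (b +i* y)) * cabs ((b - x0) +i* (y - y0)) < b - x0) ->
  False.
Proof.
move=> /andP[ax0 x0b] /andP[cy0 y0d] de e1 Hc Hd Ha Hb.
pose z0 : C := x0 +i* y0.
have [v ev] := de z0.
pose Phi z := if z == z0 then - v else (1 - e z) * (z - z0)^-1.
have PhiE z : z != z0 -> Phi z = (1 - e z) * (z - z0)^-1 by rewrite /Phi => /negPf ->.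
have dPhi s : s != z0 -> exists w, cdiff Phi s w.
  move=> sz0; have s0 : s - z0 != 0 by rewrite subr_eq0.
  have [w ew] := de s.
  have /derivable_cdiff[w' Hw'] : derivable ((fun z => (1 - e z) * (z - z0)^-1) : C^o -> C^o) s 1.
    apply: (@derivableM _ C^o (fun z => 1 - e z) (fun z => (z - z0)^-1)).
      apply: (@derivableB _ C^o C^o (cst 1) e); first exact: derivable_cst.
      exact: cdiff_derivable ew.
    apply: (@derivableV _ C^o (fun z => z - z0)) => //.
  exists w'; apply: cdiff_near Hw'; first by rewrite -cabs_gt0 in s0; exact: s0.
  move=> h hs; apply: PhiE; apply/eqP => shz.
  by move: hs; rewrite -shz opprD addrA subrr sub0r cabsN ltxx.
have cPhi s t : 0 < t -> exists2 d : R, 0 < d &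
    forall h, cabs h < d -> cabs (Phi (s + h) - Phi s) < t.
  move=> t0; have [->|/dPhi[w /cdiff_cont]] := eqVneq s z0; last exact.
  have t20 : 0 < t / 2 by rewrite divr_gt0.
  have [dl dl0 H] := ev _ t20; exists dl => // h hd.
  have [->|h0] := eqVneq h 0; first by rewrite addr0 subrr cabs0.
  have zh : z0 + h != z0 by rewrite -subr_eq0 addrC addKr.
  rewrite PhiE// /Phi eqxx addrAC subrr add0r opprK.
  have -> : (1 - e (z0 + h)) * h^-1 + v = - ((e (z0 + h) - e z0 - v * h) * h^-1).
    by rewrite e1; field.
  rewrite cabsN cabsM cabsV; apply: (@le_lt_trans _ _ (t / 2)).
    by rewrite ler_pdivrMr ?cabs_gt0//; exact: H.
  by rewrite ltr_pdivrMr// ltr_pMr// ltr1n.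
have /choice[U HU] : forall y, exists F : R -> R, forall x, a - 1 < x ->
    is_derive x 1 F (Im (Phi (x +i* y))).
  by move=> y; apply: continuous_primitive; exact: continuous_Im_line.
have /choice[V HV] : forall x, exists F : R -> R, forall y, c - 1 < y ->
    is_derive y 1 F (Re (Phi (x +i* y))).
  by move=> x; apply: continuous_primitive; exact: continuous_Re_line.
have ltm1 (u t : R) : u <= t -> u - 1 < t.
  by apply: lt_le_trans; rewrite ltrBlDr ltrDl.
have gr a' b' c' d' : a <= a' -> a' <= b' -> c <= c' -> c' <= d' ->
    [|| b' < x0, x0 < a', d' < y0 | y0 < c'] -> rect_integral U V a' b' c' d' = 0.
  move=> aa' ab cc' cd out.
  apply: (@goursat _ (fun x y => Im (Phi (x +i* y))) (fun x y => Re (Phi (x +i* y)))) => //.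
  - by move=> x y /andP[x1 _] _; apply: HU; apply: ltm1; exact: le_trans x1.
  - by move=> x y _ /andP[y1 _]; apply: HV; apply: ltm1; exact: le_trans y1.
  move=> x y /andP[x1 x2] /andP[y1 y2].
  have [|w] := dPhi (x +i* y); last exact: closed_of_cdiff.
  rewrite eq_complex /= negb_and; apply/orP; move: out => /or4P[h|h|h|h].
  - by left; rewrite lt_eqF//; exact: le_lt_trans h.
  - by left; rewrite gt_eqF//; exact: lt_le_trans x1.
  - by right; rewrite lt_eqF//; exact: le_lt_trans h.
  - by right; rewrite gt_eqF//; exact: lt_le_trans y1.
have side z w : z != z0 -> cabs w = 1 ->
    cabs (e z) * cabs (z - z0) < Im (w * (z - z0)^*) -> 0 < Im (w * Phi z).
  by move=> zz0 w1 h; rewrite PhiE//; apply: Im_side; rewrite ?subr_eq0.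
have ab : a < b by exact: lt_trans x0b.
have cd : c < d by exact: lt_trans y0d.
have pos : 0 < rect_integral U V a b c d.
  have p1 : 0 < U c b - U c a.
    apply: derive_increment_gt0 ab _ _; first by move=> x /andP[x1 _]; apply: HU; exact: ltm1.
    move=> x xab; have := @side (x +i* c) 1; rewrite !mul1r /= opprB; apply.
    - by rewrite eq_complex negb_and /= (lt_eqF cy0) orbT.
    - exact: cabs1.
    - exact: Hc.
  have p2 : 0 < - (U d b - U d a).
    rewrite (_ : - (U d b - U d a) = (\- U d) b - (\- U d) a); last by rewrite /= opprB opprK addrC.
    apply: (derive_increment_gt0 ab (g := fun x => - Im (Phi (x +i* d)))).
      by move=> x /andP[x1 _]; have := HU d x (ltm1 _ _ x1) => h; exact: is_deriveN.
    move=> x xab; have := @side (x +i* d) (-1).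
    rewrite !mulN1r !ImN /= opprK; apply.
    - by rewrite eq_complex negb_and /= (gt_eqF y0d) orbT.
    - exact: etrans (cabsN 1) (cabs1 R).
    - exact: Hd.
  have p3 : 0 < V b d - V b c.
    apply: derive_increment_gt0 cd _ _; first by move=> y /andP[y1 _]; apply: HV; exact: ltm1.
    move=> y ycd; have := @side (b +i* y) 'i; rewrite !Im_mulI /=; apply.
    - by rewrite eq_complex negb_and /= (gt_eqF x0b).
    - exact: cabs_i.
    - exact: Hb.
  have p4 : 0 < - (V a d - V a c).
    rewrite (_ : - (V a d - V a c) = (\- V a) d - (\- V a) c); last by rewrite /= opprB opprK addrC.
    apply: (derive_increment_gt0 cd (g := fun y => - Re (Phi (a +i* y)))).
      by move=> y /andP[y1 _]; have := HV a y (ltm1 _ _ y1) => h; exact: is_deriveN.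
    move=> y ycd; have := @side (a +i* y) (- 'i).
    rewrite !mulNr !ImN !Im_mulI /= opprB; apply.
    - by rewrite eq_complex negb_and /= (lt_eqF ax0).
    - exact: etrans (cabsN 'i) cabs_i.
    - exact: Ha.
  by rewrite /rect_integral; lra.
suff z : rect_integral U V a b c d = 0 by rewrite z ltxx in pos.
have [dl dl0 Hdl] := cPhi z0 1 ltr01.
pose M := cabs (Phi z0) + 1.
have PM (x y : R) : `|x - x0| < dl / 2 -> `|y - y0| < dl / 2 -> cabs (Phi (x +i* y)) <= M.
  move=> hx hy.
  have -> : x +i* y = z0 + ((x - x0) +i* (y - y0)).
    by apply/eqP; rewrite eq_complex /= !(addrC x0) !(addrC y0) !subrK !eqxx.
  set h : C := _ +i* _.
  have hd : cabs h < dl.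
    by apply: le_lt_trans (cabs_le_ReIm _ _) _; rewrite (splitr dl) ltrD.
  rewrite -[Phi _](subrK (Phi z0)) /M addrC; apply: le_trans (cabsD _ _) _.
  by rewrite lerD2l ltW// Hdl.
have M0 : 0 < M by rewrite ltr_wpDl// cabs_ge0.
apply/normr0_eq0/eqP; rewrite eq_le normr_ge0 andbT.
apply/ler_addgt0Pl => t t0; rewrite addr0.
pose r := Num.min (dl / 4) (Num.min (t / (8 * M)) (Num.min (Num.min (x0 - a) (b - x0)) (Num.min (y0 - c) (d - y0)))).
have r0 : 0 < r by rewrite !lt_min !subr_gt0 ax0 x0b cy0 y0d !divr_gt0// mulr_gt0.
have [r1 [r2 [[r3 r4] [r5 r6]]]] : r <= dl / 4 /\ r <= t / (8 * M) /\
   (r <= x0 - a /\ r <= b - x0) /\ (r <= y0 - c /\ r <= d - y0).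
  have : r <= r by []. rewrite {2}/r !le_min => /andP[-> /andP[-> /andP[/andP[-> ->] /andP[-> ->]]]].
  by [].
have rdl : r < dl / 2 by apply: le_lt_trans r1 _; lra.
(* excision of a small square around z0, on which Phi is bounded by M *)
have -> : rect_integral U V a b c d = rect_integral U V (x0 - r) (x0 + r) (y0 - r) (y0 + r)
   + rect_integral U V a (x0 - r) c d + rect_integral U V (x0 + r) b c d
   + rect_integral U V (x0 - r) (x0 + r) c (y0 - r) + rect_integral U V (x0 - r) (x0 + r) (y0 + r) d.
  by rewrite /rect_integral; ring.
have itv (l u q : R) : r <= q - l -> r <= u - q ->
    [/\ l <= q - r, q - r < q, q - r <= q + r, q < q + r & q + r <= u].
  by move: r0; clear; move=> *; split; lra.
have [xl xl' xr xr' xu] := itv _ _ _ r3 r4; have [yl yl' yr yr' yu] := itv _ _ _ r5 r6.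
have xl2 := le_trans xl xr; have yl2 := le_trans yl yr.
rewrite (gr a (x0 - r) c d) ?(ltW cd) ?xl' ?xl// (gr (x0 + r) b c d) ?(ltW cd) ?xr' ?orbT//.
rewrite (gr _ _ c (y0 - r)) ?yl' ?orbT// (gr _ _ (y0 + r) d) ?yr' ?orbT// !addr0.
have nr x : x0 - r <= x <= x0 + r -> `|x - x0| < dl / 2.
  by move=> h; apply: le_lt_trans rdl; rewrite ler_distl.
have nr' y : y0 - r <= y <= y0 + r -> `|y - y0| < dl / 2.
  by move=> h; apply: le_lt_trans rdl; rewrite ler_distl.
have bU y : y0 - r <= y <= y0 + r -> `|U y (x0 + r) - U y (x0 - r)| <= M * (2 * r).
  move=> hy; have -> : 2 * r = (x0 + r) - (x0 - r) by ring.
  apply: (le_derive_increment xr (g := fun x => Im (Phi (x +i* y)))).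
    by move=> x /andP[h1 h2]; apply: HU; apply: ltm1; exact: le_trans h1.
  by move=> x hx; apply: le_trans (Im_le_cabs _) _; apply: PM; [exact: nr|exact: nr'].
have bV x : x0 - r <= x <= x0 + r -> `|V x (y0 + r) - V x (y0 - r)| <= M * (2 * r).
  move=> hx; have -> : 2 * r = (y0 + r) - (y0 - r) by ring.
  apply: (le_derive_increment yr (g := fun y => Re (Phi (x +i* y)))).
    by move=> y /andP[h1 h2]; apply: HV; apply: ltm1; exact: le_trans h1.
  by move=> y hy; apply: le_trans (Re_le_cabs _) _; apply: PM; [exact: nr|exact: nr'].
rewrite /rect_integral.
apply: le_trans (ler_normB _ _) _; apply: le_trans (lerD (ler_normB _ _) (lexx _)) _.
apply: le_trans (lerD (lerD (ler_normD _ _) (lexx _)) (lexx _)) _.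
apply: (@le_trans _ _ (M * (2 * r) + M * (2 * r) + M * (2 * r) + M * (2 * r))).
  by rewrite !lerD// ?bU ?bV// lexx ?xr ?yr.
have -> : M * (2 * r) + M * (2 * r) + M * (2 * r) + M * (2 * r) = r * (8 * M) by ring.
by rewrite -ler_pdivlMr// mulr_gt0.
Qed.

End Cx.

(** * Identity theorem for entire functions *)

Section Cx.
Variable R : realType.
Local Notation C := R[i].
Local Notation cabs := (@Normc.normc R).
Local Notation Re := (@complex.Re R).
Local Notation Im := (@complex.Im R).
Implicit Types (z s h w : C) (f g : C -> C).

Lemma bounded_segment (F : C -> C) (z dz : C) (a b : R) :
  (forall s, exists v, cdiff F s v) -> cabs dz = 1 -> a <= b ->
  exists M, forall t, a <= t <= b -> cabs (F (z + t%:C * dz)) <= M.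
Proof.
move=> dF dz1 ab.
have cF : continuous (fun t : R => cabs (F (z + t%:C * dz))).
  apply: (@continuous_line _ (fun z => cabs (F z)) F) => //.
    move=> s t; rewrite ler_norml; apply/andP; split.
      rewrite lerNl opprB lerBlDr cabs_distC -[in leLHS](subrK (F s) (F t)); exact: cabsD.
    by rewrite lerBlDr -[in leLHS](subrK (F t) (F s)); exact: cabsD.
  by move=> s e; have [v /cdiff_cont] := dF s; apply.
have [t _ tM] := EVT_max ab (continuous_subspaceT cF).
by exists (cabs (F (z + t%:C * dz))) => t' ?; apply: tM; rewrite in_itv.
Qed.

(** The auxiliary function e has a pole of order k + 1 at w in appearance
    only, since g vanishes near w; the power makes e small on the boundary of
    a square that is larger than the distance from w to z. *)
Lemma entire_eq0_near g w (r : R) : 0 < r ->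
  (forall s, exists v, cdiff g s v) ->
  (forall h, cabs h < r -> g (w + h) = 0) -> forall z, g z = 0.
Proof.
move=> r0 dg gw z; apply/eqP/negPn/negP => gz.
have zw : z != w by apply: contraNneq gz => ->; rewrite -[w]addr0 gw ?cabs0.
have gz0 : 0 < cabs (g z) by rewrite cabs_gt0.
pose rho := cabs (z - w); pose s := rho + 1.
have rho0 : 0 <= rho := cabs_ge0 _.
have s0 : 0 < s by rewrite ltr_wpDl.
have srho : rho < s by rewrite ltrDl.
have zxy : z = Re z +i* Im z by case: (z).
have wxy : w = Re w +i* Im w by case: (w).
move: zxy wxy; set x0 := Re z; set y0 := Im z; set wx := Re w; set wy := Im w => zxy wxy.
have [bx by_] : `|x0 - wx| <= rho /\ `|y0 - wy| <= rho.
  have := Re_le_cabs (z - w); have := Im_le_cabs (z - w).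
  by rewrite /rho /x0 /y0 /wx /wy; case: (z) => ? ?; case: (w).
have ss : - s <= s by rewrite -subr_ge0 opprK addr_ge0// ltW.
have cabsi := cabs_i R.
have [M1 HM1] := bounded_segment (w + (0 -i* s)) dg (cabs1 R) ss.
have [M2 HM2] := bounded_segment (w + (0 +i* s)) dg (cabs1 R) ss.
have [M3 HM3] := bounded_segment (w + (- s +i* 0)) dg cabsi ss.
have [M4 HM4] := bounded_segment (w + (s +i* 0)) dg cabsi ss.
pose M := Num.max (Num.max M1 M2) (Num.max M3 M4).
have [le1 le2 le3 le4] : [/\ M1 <= M, M2 <= M, M3 <= M & M4 <= M].
  by rewrite /M !le_max !lexx ?orbT.
have M0 : 0 <= M.
  by apply: le_trans le1; apply: le_trans (cabs_ge0 _) (HM1 s _); rewrite lexx ss.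
have [k Hk] : exists k : nat, M / cabs (g z) * (3 * s) * (rho / s) ^+ k < 1.
  have q1 : `|rho / s| < 1 by rewrite ger0_norm ?divr_ge0 ?(ltW s0)// ltr_pdivrMr// mul1r.
  have /cvgrPdist_lt/(_ 1 ltr01)[k _ /(_ k (leqnn _))] :=
    cvg_geometric (M / cabs (g z) * (3 * s)) q1.
  by rewrite /= sub0r normrN => h; exists k; apply: le_lt_trans h; exact: ler_norm.
(* the bound M on the square is beaten by the geometric factor (rho / s)^k *)
pose e u := g u * (g z)^-1 * ((z - w) * (u - w)^-1) ^+ k.+1.
have de u : exists v, cdiff e u v.
  have [->|uw] := eqVneq u w.
    exists 0; apply: (@cdiff_near _ (fun _ => 0) _ _ _ r r0).
      by move=> h hr; rewrite /e gw// !mul0r.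
    by move=> t t0; exists 1 => // h _; rewrite subrr mul0r subrr cabs0 mulr_ge0 ?cabs_ge0// ltW.
  apply: derivable_cdiff; have [v gv] := dg u.
  have dgC : derivable (g : C^o -> C^o) u 1 by exact: cdiff_derivable gv.
  have dV : derivable ((fun u => (z - w) * (u - w)^-1) : C^o -> C^o) u 1.
    apply: (@derivableM _ C^o (cst (z - w)) (fun u => (u - w)^-1)); first exact: derivable_cst.
    have uw0 : u - w != 0 by rewrite subr_eq0.
    apply: (@derivableV _ C^o (fun u => u - w)); first exact: uw0.
    by apply: (@derivableB _ C^o C^o id (cst w)); [exact: derivable_id|exact: derivable_cst].
  have dX m : derivable ((fun u => ((z - w) * (u - w)^-1) ^+ m) : C^o -> C^o) u 1.
    elim: m => [|m IH]; first exact: derivable_cst.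
    rewrite (_ : (fun u => _) =
      (fun u => ((z - w) * (u - w)^-1) * ((z - w) * (u - w)^-1) ^+ m)); last first.
      by apply/funext => t; rewrite exprS.
    exact: (@derivableM _ C^o (fun u => (z - w) * (u - w)^-1)
      (fun u => ((z - w) * (u - w)^-1) ^+ m) u 1 dV IH).
  apply: (@derivableM _ C^o (fun u => g u * (g z)^-1) (fun u => ((z - w) * (u - w)^-1) ^+ k.+1)); last exact: dX.
  by apply: (@derivableM _ C^o g (cst (g z)^-1) u 1 dgC); exact: derivable_cst.
have ez : e (x0 +i* y0) = 1.
  by rewrite -zxy /e divff// divff ?subr_eq0// expr1n mulr1.
have small u : cabs (g u) <= M -> s <= cabs (u - w) -> cabs (u - w) <= 2 * s ->
    cabs (e u) * cabs (u - z) < 1.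
  move=> uM us us2; apply: le_lt_trans Hk.
  have u0 : 0 < cabs (u - w) by exact: lt_le_trans us.
  have uz : cabs (u - z) <= 3 * s.
    have -> : u - z = (u - w) - (z - w) by rewrite opprB addrA subrK.
    apply: le_trans (cabsB _ _) _; rewrite -/rho (_ : 3 * s = 2 * s + s); last by ring.
    by rewrite lerD// ltW.
  rewrite /e !cabsM cabsX cabsM !cabsV -/rho [leRHS]mulrAC.
  have B0 : 0 <= (rho / cabs (u - w)) ^+ k.+1 by rewrite exprn_ge0// divr_ge0// cabs_ge0.
  have A0 : 0 <= cabs (g u) / cabs (g z) by rewrite divr_ge0// cabs_ge0.
  apply: ler_pM uz; [exact: mulr_ge0|exact: cabs_ge0|].
  apply: ler_pM => //.
    by rewrite ler_pM2r// invr_gt0.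
  apply: (@le_trans _ _ ((rho / s) ^+ k.+1)).
    by rewrite lerXn2r// ?nnegrE ?divr_ge0 ?cabs_ge0 ?(ltW s0)// ler_wpM2l// lef_pV2.
  rewrite exprS ler_piMl ?exprn_ge0 ?divr_ge0 ?(ltW s0)//; apply: ltW.
  by rewrite ltr_pdivrMr// mul1r.
have side (a b : R) : cabs (g (w + (a +i* b))) <= M -> `|a| <= s -> `|b| <= s ->
    s <= Num.max `|a| `|b| ->
    cabs (e (w + (a +i* b))) * cabs (w + (a +i* b) - z) < 1.
  move=> gM as_ bs sab; apply: small => //; rewrite [w + _]addrC addrK.
    apply: le_trans sab _; rewrite ge_max.
    by rewrite (Re_le_cabs (a +i* b)) (Im_le_cabs (a +i* b)).
  by apply: le_trans (cabs_le_ReIm _ _) _; rewrite mulr_natl mulr2n lerD.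
have snorm : `|s| = s by rewrite gtr0_norm.
have nsnorm : `|- s| = s by rewrite normrN.
have gap (t t0 : R) : `|t - t0| <= rho ->
    [/\ t0 - s < t < t0 + s, 1 <= t - (t0 - s) & 1 <= t0 + s - t].
  rewrite /s ler_distl; move=> /andP[]; clear; move=> *; split; [apply/andP; split|..]; lra.
have [xin x1 x2] := gap _ _ bx; have [yin y1 y2] := gap _ _ by_.
have toz (a b : R) : (a - x0) +i* (b - y0) = (a +i* b) - z by rewrite zxy.
have fromw (a b : R) : a +i* b = w + ((a - wx) +i* (b - wy)).
  by rewrite wxy; apply/eqP; rewrite eq_complex /= !(addrC wx) !(addrC wy) !subrK !eqxx.
have shift (t u : R) : (t + u) - t = u by rewrite addrC addKr.
apply: (@cauchy_rect _ e (wx - s) (wx + s) (wy - s) (wy + s) x0 y0) => //.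
- move=> x; rewrite -ler_distl => xs; apply: lt_le_trans y1; rewrite toz fromw shift.
  apply: side; [apply: le_trans le1|exact: xs|by rewrite nsnorm|by rewrite nsnorm le_max lexx orbT].
  have /HM1 : - s <= x - wx <= s by rewrite -ler_norml.
  congr (cabs (g _) <= _); rewrite -addrA; congr (w + _); apply/eqP.
  by rewrite eq_complex /= !(mulr0, mulr1, mul0r, subr0, addr0, add0r) !eqxx.
- move=> x; rewrite -ler_distl => xs; apply: lt_le_trans y2; rewrite toz fromw shift.
  apply: side; [apply: le_trans le2|exact: xs|by rewrite snorm|by rewrite snorm le_max lexx orbT].
  have /HM2 : - s <= x - wx <= s by rewrite -ler_norml.
  congr (cabs (g _) <= _); rewrite -addrA; congr (w + _); apply/eqP.
  by rewrite eq_complex /= !(mulr0, mulr1, mul0r, subr0, addr0, add0r) !eqxx.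
- move=> y; rewrite -ler_distl => ys; apply: lt_le_trans x1; rewrite toz fromw shift.
  apply: side; [apply: le_trans le3|by rewrite nsnorm|exact: ys|by rewrite nsnorm le_max lexx].
  have /HM3 : - s <= y - wy <= s by rewrite -ler_norml.
  congr (cabs (g _) <= _); rewrite -addrA; congr (w + _); apply/eqP.
  by rewrite eq_complex /= !(mulr0, mulr1, mul0r, subr0, addr0, add0r) !eqxx.
- move=> y; rewrite -ler_distl => ys; apply: lt_le_trans x2; rewrite toz fromw shift.
  apply: side; [apply: le_trans le4|by rewrite snorm|exact: ys|by rewrite snorm le_max lexx].
  have /HM4 : - s <= y - wy <= s by rewrite -ler_norml.
  congr (cabs (g _) <= _); rewrite -addrA; congr (w + _); apply/eqP.
  by rewrite eq_complex /= !(mulr0, mulr1, mul0r, subr0, addr0, add0r) !eqxx.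
Qed.

Lemma entire_unique f g : entire f -> entire g ->
  (forall s, 1 < Re s -> f s = g s) -> f = g.
Proof.
move=> ef eg fg; apply/funext => z; apply/eqP; rewrite -subr_eq0; apply/eqP.
apply: (@entire_eq0_near (fun z => f z - g z) 2%:R 1 ltr01) => [s|h h1].
  by apply: derivable_cdiff; apply: (@derivableB _ C^o C^o f g).
apply/eqP; rewrite subr_eq0; apply/eqP/fg.
have := le_lt_trans (Re_le_cabs h) h1; rewrite ltr_norml => /andP[h2 _].
rewrite -[2%:R]/(1 + 1); case: h {h1} h2 => a b /=; lra.
Qed.

End Cx.

(** * Calculus of complex functions of a real variable *)

Section Cx.
Variable R : realType.
Local Notation C := R[i].
Local Notation cabs := (@Normc.normc R).
Local Notation Re := (@complex.Re R).
Local Notation Im := (@complex.Im R).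

Definition cderiv (F : R -> C) (x : R) (D : C) :=
  is_derive x 1 (fun x => Re (F x)) (Re D) /\ is_derive x 1 (fun x => Im (F x)) (Im D).

Lemma cderivD F G x D E : cderiv F x D -> cderiv G x E -> cderiv (fun x => F x + G x) x (D + E).
Proof.
move=> [F1 F2] [G1 G2]; split.
  rewrite (_ : (fun _ => _) = (fun x => Re (F x) + Re (G x))); last first.
    by apply/funext => y; case: (F y); case: (G y).
  by apply: is_derive_eq; case: (D); case: (E).
rewrite (_ : (fun _ => _) = (fun x => Im (F x) + Im (G x))); last first.
  by apply/funext => y; case: (F y); case: (G y).
by apply: is_derive_eq; case: (D); case: (E).
Qed.

Lemma cderiv_cst (c : C) x : cderiv (fun=> c) x 0.
Proof. by split; apply: is_derive_cst. Qed.

Lemma cderivZ (c : C) F x D : cderiv F x D -> cderiv (fun x => c * F x) x (c * D).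
Proof.
move=> [F1 F2]; split.
  rewrite (_ : (fun _ => _) = (fun x => Re c * Re (F x) - Im c * Im (F x))); last first.
    by apply/funext => y; case: (F y); case: (c).
  by apply: is_derive_eq; rewrite /GRing.scale /=; case: (D); case: (c) => /= *; ring.
rewrite (_ : (fun _ => _) = (fun x => Re c * Im (F x) + Im c * Re (F x))); last first.
  by apply/funext => y; case: (F y); case: (c).
by apply: is_derive_eq; rewrite /GRing.scale /=; case: (D); case: (c) => /= *; ring.
Qed.

Lemma cderivB F G x D E : cderiv F x D -> cderiv G x E -> cderiv (fun x => F x - G x) x (D - E).
Proof.
move=> dF /(cderivZ (-1)) dG; rewrite -[- E]mulN1r.
rewrite (_ : (fun _ => _) = (fun x => F x + -1 * G x)); first exact: cderivD.
by apply/funext => y; rewrite mulN1r.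
Qed.

Lemma cderiv_sum (I : Type) (r : seq I) (F : I -> R -> C) x (D : I -> C) :
  (forall i, cderiv (F i) x (D i)) -> cderiv (fun x => \sum_(i <- r) F i x) x (\sum_(i <- r) D i).
Proof.
move=> dF; elim: r => [|i r IH].
  rewrite big_nil (_ : (fun _ => _) = fun=> 0); first exact: cderiv_cst.
  by apply/funext => y; rewrite big_nil.
rewrite big_cons (_ : (fun _ => _) = fun x => F i x + \sum_(i <- r) F i x); first exact: cderivD.
by apply/funext => y; rewrite big_cons.
Qed.

Lemma cderiv_comp F (g : R -> R) x D dg : cderiv F (g x) D -> is_derive x 1 g dg ->
  cderiv (fun x => F (g x)) x (dg%:C * D).
Proof.
move=> [F1 F2] G; split.
  rewrite (_ : Re (dg%:C * D) = Re D * dg); last by case: (D) => ? ? /=; rewrite mul0r subr0 mulrC.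
  exact: (@is_derive1_comp R (fun x => Re (F x)) g).
rewrite (_ : Im (dg%:C * D) = Im D * dg); last by case: (D) => ? ? /=; rewrite mul0r addr0 mulrC.
exact: (@is_derive1_comp R (fun x => Im (F x)) g).
Qed.

Lemma cderiv_shift F (a : R) x D : cderiv F (x + a) D -> cderiv (fun x => F (x + a)) x D.
Proof.
move=> dF; rewrite -[D]mul1r; apply: (@cderiv_comp F (fun x => x + a)) => //.
by apply: is_derive_eq; rewrite addr0.
Qed.

(** The factor 2 comes from treating the real and imaginary parts separately. *)
Lemma cderiv_increment F D (a b M : R) : a <= b -> (forall x, a <= x <= b -> cderiv F x (D x)) ->
  (forall x, a <= x <= b -> cabs (D x) <= M) -> cabs (F b - F a) <= 2 * M * (b - a).
Proof.
move=> ab dF DM.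
have h1 : `|Re (F b) - Re (F a)| <= M * (b - a).
  apply: (@le_derive_increment R (fun x => Re (F x)) (fun x => Re (D x))) => // x xab.
    by have [] := dF x xab.
  exact: le_trans (Re_le_cabs _) (DM x xab).
have h2 : `|Im (F b) - Im (F a)| <= M * (b - a).
  apply: (@le_derive_increment R (fun x => Im (F x)) (fun x => Im (D x))) => // x xab.
    by have [] := dF x xab.
  exact: le_trans (Im_le_cabs _) (DM x xab).
rewrite -mulrA mulr_natl mulr2n.
have -> : F b - F a = (Re (F b) - Re (F a)) +i* (Im (F b) - Im (F a)).
  by case: (F b) => ? ?; case: (F a).
by apply: le_trans (cabs_le_ReIm _ _) _; exact: lerD.
Qed.

(** The complex exponential exp (- w t) of the real variable t. *)
Definition cexpN (w : C) (t : R) : C :=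
  let: a +i* b := w in
  let r := expR (- (a * t)) in (r * cos (b * t)) +i* (- (r * sin (b * t))).

Lemma npowNE m s : npowN m s = cexpN s (ln m%:R).
Proof. by case: s. Qed.

Lemma cabs_cexpN w t : cabs (cexpN w t) = expR (- (Re w * t)).
Proof.
apply/eqP; rewrite -(@eqrXn2 _ 2)// ?cabs_ge0 ?expR_ge0// cabs_sqr; case: w => a b /=.
by rewrite sqrrN !exprMn -mulrDr cos2Dsin2 mulr1.
Qed.

Lemma cexpN_addl w v t : cexpN (w + v) t = cexpN w t * cexpN v t.
Proof.
case: w v => a b [c d]; apply/eqP; rewrite eq_complex /= !mulrDl opprD expRD cosD sinD.
by apply/andP; split; apply/eqP; ring.
Qed.

(** With t = ln x this is (ln x)^i x^(-w); the powers of the logarithm arise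
    by differentiating x^(-w) in w. *)
Definition pow_cexpN (i : nat) (w : C) (t : R) : C := (t ^+ i)%:C * cexpN w t.

Lemma is_derive_pow (i : nat) (t : R) :
  is_derive t 1 (fun t : R => t ^+ i) (i%:R * t ^+ i.-1).
Proof.
have := @is_deriveX R R^o id i t 1 1 (is_derive_id _ _).
rewrite (_ : _ *: 1 = i%:R * t ^+ i.-1); last by rewrite /GRing.scale /= mulr1.
rewrite (_ : id ^+ i = (fun t : R => t ^+ i))//.
apply/funext => y; elim: (i) => [|n IH]; first by rewrite !expr0.
by rewrite !exprS -IH.
Qed.

Lemma is_derive_expR_comp (g : R -> R) (t dg : R) : is_derive t 1 g dg ->
  is_derive t 1 (fun t => expR (g t)) (expR (g t) * dg).
Proof. by move=> dg'; apply: (@is_derive1_comp R expR g). Qed.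

Lemma is_derive_cos_comp (g : R -> R) (t dg : R) : is_derive t 1 g dg ->
  is_derive t 1 (fun t => cos (g t)) (- sin (g t) * dg).
Proof. by move=> dg'; apply: (@is_derive1_comp R cos g). Qed.

Lemma is_derive_sin_comp (g : R -> R) (t dg : R) : is_derive t 1 g dg ->
  is_derive t 1 (fun t => sin (g t)) (cos (g t) * dg).
Proof. by move=> dg'; apply: (@is_derive1_comp R sin g). Qed.

Lemma cderiv_pow_cexpN i w t : cderiv (pow_cexpN i w) t (i%:R * pow_cexpN i.-1 w t - w * pow_cexpN i w t).
Proof.
rewrite /pow_cexpN; case: w => a b; have iE : (i%:R : C) = (i%:R)%:C by rewrite rmorph_nat.
have dp := is_derive_pow i t.
have da : is_derive t 1 (fun t : R => - (a * t)) (- a).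
  by apply: is_derive_eq; rewrite /GRing.scale /= mulr1.
have db : is_derive t 1 (fun t : R => b * t) b.
  by apply: is_derive_eq; rewrite /GRing.scale /= mulr1.
have de := is_derive_expR_comp da.
have dc := is_derive_cos_comp db; have ds := is_derive_sin_comp db.
split.
  rewrite (_ : (fun _ => _) = (fun t => t ^+ i * (expR (- (a * t)) * cos (b * t)))); last first.
    by apply/funext => y /=; rewrite mul0r subr0.
  apply: is_derive_eq; rewrite iE /GRing.scale /=; ring.
rewrite (_ : (fun _ => _) = (fun t => t ^+ i * (- (expR (- (a * t)) * sin (b * t))))); last first.
  by apply/funext => y /=; rewrite mul0r addr0.
apply: is_derive_eq; rewrite iE /GRing.scale /=; ring.
Qed.

Lemma cderiv_pow_cexpN_par i (s h : C) (t x : R) :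
  cderiv (fun x => pow_cexpN i (s + x%:C * h) t) x (- h * pow_cexpN i.+1 (s + x%:C * h) t).
Proof.
rewrite /pow_cexpN; case: s h => a b [p q].
have da : is_derive x 1 (fun x : R => - ((a + x * p) * t)) (- (p * t)).
  by apply: is_derive_eq; rewrite /GRing.scale /=; ring.
have db : is_derive x 1 (fun x : R => (b + x * q) * t) (q * t).
  by apply: is_derive_eq; rewrite /GRing.scale /=; ring.
have de := is_derive_expR_comp da.
have dc := is_derive_cos_comp db; have ds := is_derive_sin_comp db.
split.
  rewrite (_ : (fun _ => _) = (fun x => t ^+ i * (expR (- ((a + x * p) * t)) * cos ((b + x * q) * t)))); last first.
    by apply/funext => y /=; rewrite !(mul0r, subr0, addr0).
  apply: is_derive_eq; rewrite /GRing.scale /= !(mul0r, subr0, addr0) exprS; ring.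
rewrite (_ : (fun _ => _) = (fun x => t ^+ i * (- (expR (- ((a + x * p) * t)) * sin ((b + x * q) * t))))); last first.
  by apply/funext => y /=; rewrite !(mul0r, subr0, addr0).
apply: is_derive_eq; rewrite /GRing.scale /= !(mul0r, subr0, addr0) exprS; ring.
Qed.

End Cx.

(** * Finite differences of (ln x)^i x^(-s) *)

Section Cx.
Variable R : realType.
Local Notation C := R[i].
Local Notation cabs := (@Normc.normc R).
Local Notation Re := (@complex.Re R).
Local Notation Im := (@complex.Im R).
Implicit Types (i J : nat) (s w h : C) (x t : R).

Definition fdiff (F : R -> C) x := F (x + 1) - F x.

(** The J-th forward difference of (ln x)^i x^(-s). *)
Definition diff_logpow i s J : R -> C := iter J fdiff (fun x => pow_cexpN i s (ln x)).

Lemma diff_logpowS i s J x : diff_logpow i s J.+1 x = diff_logpow i s J (x + 1) - diff_logpow i s J x.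
Proof. by []. Qed.

Lemma cexpN1_ln x : 0 < x -> cexpN 1 (ln x) = x^-1%:C.
Proof.
move=> x0; rewrite /cexpN -[1]/((1 : R)%:C) /= mul1r mul0r cos0 sin0 mulr1 mulr0 oppr0.
by rewrite expRN lnK// posrE.
Qed.

Lemma cderiv_diff_logpow i s J x : 0 < x ->
  cderiv (diff_logpow i s J) x (i%:R * diff_logpow i.-1 (s + 1) J x - s * diff_logpow i (s + 1) J x).
Proof.
elim: J x => [|J IH] x x0.
  have := cderiv_comp (cderiv_pow_cexpN i s (ln x)) (is_derive1_ln x0).
  rewrite (_ : x^-1%:C * _ = i%:R * pow_cexpN i.-1 (s + 1) (ln x) - s * pow_cexpN i (s + 1) (ln x))//.
  by rewrite /pow_cexpN !cexpN_addl cexpN1_ln//; ring.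
have x10 : 0 < x + 1 by rewrite addr_gt0.
have := cderivB (cderiv_shift (IH (x + 1) x10)) (IH x x0).
congr cderiv; rewrite !diff_logpowS; ring.
Qed.

Lemma cderiv_diff_logpow_par i s h J x t :
  cderiv (fun t => diff_logpow i (s + t%:C * h) J x) t (- h * diff_logpow i.+1 (s + t%:C * h) J x).
Proof.
elim: J x => [|J IH] x; first exact: cderiv_pow_cexpN_par.
by have := cderivB (IH (x + 1)) (IH x); rewrite -mulrBr.
Qed.

Lemma pow_le_expR i t : 0 <= t -> t ^+ i <= (i%:R ^+ i + 1) * expR t.
Proof.
move=> t0; case: i => [|i].
  rewrite expr0 expr0 -[leLHS]mulr1; apply: ler_pM => //; first by rewrite lerDl.
  by rewrite -expR0 ler_expR.
apply: (@le_trans _ _ (i.+1%:R ^+ i.+1 * expR t)); last first.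
  by rewrite ler_wpM2r ?expR_ge0// lerDl.
have i0 : 0 < i.+1%:R :> R by rewrite ltr0n.
have -> : expR t = expR (t / i.+1%:R) ^+ i.+1.
  by rewrite -expRM_natl mulrC divfK// gt_eqF.
rewrite -exprMn; apply: lerXn2r; rewrite ?nnegrE ?mulr_ge0 ?expR_ge0//.
rewrite mulrC -ler_pdivrMr //.
by have := @expR_ge1Dx R (t / i.+1%:R); apply: le_trans; rewrite lerDr.
Qed.

(** Each difference gains a factor 1/x: by the mean value inequality it is
    bounded by the derivative, which lowers the exponent by one and stays
    within the same family of functions.  The spare factor x absorbs the
    powers of the logarithm. *)
Lemma diff_logpow_bound J : forall i (M : R), exists K : R, 0 <= K /\
  forall s, cabs s <= M -> forall x, 1 <= x ->
    cabs (diff_logpow i s J x) <= K * expR ((1 - Re s - J%:R) * ln x).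
Proof.
elim: J => [|J IH] i M.
  exists (i%:R ^+ i + 1); split; first by rewrite addr_ge0// exprn_ge0.
  move=> s _ x x1; rewrite /diff_logpow /= /pow_cexpN cabsM cabs_cexpN cabs_real.
  have lx0 : 0 <= ln x by exact: ln_ge0.
  rewrite ger0_norm ?exprn_ge0// subr0 mulrBl mul1r expRD -mulNr mulrA.
  by rewrite ler_wpM2r ?expR_ge0// pow_le_expR.
have [K1 [K10 HK1]] := IH i.-1 (M + 1).
have [K2 [K20 HK2]] := IH i (M + 1).
pose N := `|M|; have N0 : 0 <= N := normr_ge0 M.
exists (2 * (i%:R * K1 + N * K2) * expR (N + J%:R)); split.
  by apply: mulr_ge0 (expR_ge0 _); apply: mulr_ge0 => //; apply: addr_ge0; exact: mulr_ge0.
move=> s sM x x1; have x0 : 0 < x by exact: lt_le_trans x1.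
rewrite diff_logpowS.
pose e := - Re s - J%:R.
have -> : 1 - Re s - J.+1%:R = e by rewrite /e -natr1; ring.
have s1 : cabs (s + 1) <= M + 1 by apply: le_trans (cabsD _ _) _; rewrite cabs1 lerD2r.
have Rs1 : Re (s + 1) = Re s + 1 by case: (s).
have eN : `|e| <= N + J%:R.
  rewrite /e -opprD normrN; apply: le_trans (ler_normD (Re s) J%:R) _.
  rewrite (ger0_norm (ler0n _ J)) lerD2r.
  by apply: le_trans (Re_le_cabs _) _; apply: le_trans sM _; exact: ler_norm.
have B y : x <= y <= x + 1 ->
    cabs (i%:R * diff_logpow i.-1 (s + 1) J y - s * diff_logpow i (s + 1) J y) <=
    (i%:R * K1 + N * K2) * (expR (N + J%:R) * expR (e * ln x)).
  move=> /andP[xy yx]; have y1 : 1 <= y by exact: le_trans xy.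
  have y0 : 0 < y by exact: lt_le_trans y1.
  have E : expR ((1 - Re (s + 1) - J%:R) * ln y) <= expR (N + J%:R) * expR (e * ln x).
    rewrite -expRD ler_expR Rs1 (_ : 1 - _ - _ = e); last by rewrite /e; ring.
    rewrite -lerBlDr -mulrBr; apply: le_trans (ler_norm _) _; rewrite normrM.
    have l0 : ln x <= ln y by rewrite ler_ln.
    have l1 : ln y - ln x <= 1.
      rewrite -ln_div ?posrE//; apply: (@le_trans _ _ (y / x - 1)).
        have -> : y / x = 1 + (y / x - 1) by ring.
        have -> : 1 + (y / x - 1) - 1 = y / x - 1 by ring.
        by apply: le_ln1Dx; rewrite ltrBrDl addrN divr_gt0.
      by rewrite lerBlDl ler_pdivrMr// (le_trans yx)// mulrDl mul1r lerD2l.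
    rewrite (ger0_norm (_ : 0 <= ln y - ln x)) ?subr_ge0//.
    by rewrite -[leRHS]mulr1; apply: ler_pM => //; rewrite subr_ge0.
  apply: le_trans (cabsB _ _) _; rewrite !cabsM mulrDl; apply: lerD.
    rewrite (_ : cabs i%:R = i%:R); last first.
      by rewrite -(rmorph_nat (real_complex R)) cabs_real ger0_norm.
    rewrite -mulrA ler_wpM2l//; apply: le_trans (HK1 _ s1 y y1) _.
    exact: ler_wpM2l E.
  rewrite -mulrA; apply: ler_pM; rewrite ?cabs_ge0//.
    by apply: le_trans sM _; exact: ler_norm.
  apply: le_trans (HK2 _ s1 y y1) _; exact: ler_wpM2l E.
have dL y : x <= y <= x + 1 -> cderiv (diff_logpow i s J) y (i%:R * diff_logpow i.-1 (s + 1) J y - s * diff_logpow i (s + 1) J y).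
  by move=> /andP[xy _]; apply: cderiv_diff_logpow; exact: lt_le_trans xy.
have xx1 : x <= x + 1 by rewrite lerDl.
have := cderiv_increment xx1 dL B; rewrite [x + 1 - x]addrC addKr mulr1.
by rewrite !mulrA.
Qed.

Lemma expR_ln_cvg0 (e t : R) : 0 < e -> 0 < t -> exists N0 : nat, forall N : nat, (N0 <= N)%N ->
  expR (- e * ln (N%:R + 1)) < t.
Proof.
move=> e0 t0; pose b := expR (- ln t / e).
exists (Num.bound b) => N bN.
have b1 : b < N%:R + 1.
  have := archi_boundP (expR_ge0 (- ln t / e)); rewrite -/b => /lt_trans; apply.
  by rewrite natr1 ltr_nat.
have : ln b < ln (N%:R + 1) by rewrite ltr_ln ?posrE// ?expR_gt0//.
rewrite /b expRK ltr_pdivrMr// => h.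
by rewrite -[t]lnK ?posrE// ltr_expR mulNr ltrNl mulrC.
Qed.

Lemma diff_logpow_cvg0 i s J : 1 - Re s - J%:R < 0 -> forall t, 0 < t -> exists N0 : nat,
  forall N : nat, (N0 <= N)%N -> cabs (diff_logpow i s J (N%:R + 1)) < t.
Proof.
move=> sJ t t0; have [K [K0 HK]] := diff_logpow_bound J i (cabs s).
have K1 : 0 < K + 1 by rewrite ltr_wpDl.
have [|N0 HN] := @expR_ln_cvg0 (- (1 - Re s - J%:R)) (t / (K + 1)) _ (divr_gt0 t0 K1).
  by rewrite oppr_gt0.
exists N0 => N /HN; rewrite opprK ltr_pdivlMr// => h.
apply: le_lt_trans (HK s (lexx _) (N%:R + 1) _) _; first by rewrite lerDr.
by apply: le_lt_trans h; rewrite mulrC ler_wpM2l ?expR_ge0// lerDl.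
Qed.

Lemma sum_inv_sqr n : \sum_(m < n) expR (- 2 * ln (m%:R + 1)) <= 2 :> R.
Proof.
have E m : expR (- 2 * ln (m%:R + 1)) = (m%:R + 1) ^- 2 :> R.
  rewrite mulNr expRN (_ : 2 * _ = 2%:R * ln (m%:R + 1 : R))// expRM_natl lnK//.
  by rewrite posrE ltr_wpDl.
suff H k : \sum_(m < k.+1) expR (- 2 * ln (m%:R + 1)) <= 2 - (k%:R + 1)^-1 :> R.
  case: n => [|n]; first by rewrite big_ord0.
  by apply: le_trans (H n) _; rewrite gerBl invr_ge0 addr_ge0.
elim: k => [|k IH].
  by rewrite big_ord1 /= E add0r expr1n invr1; lra.
rewrite big_ord_recr /= E; apply: le_trans (lerD IH (lexx _)) _.
have k0 : 0 < k%:R + 1 :> R by rewrite ltr_wpDl.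
rewrite -!natr1; set a : R := k%:R + 1 in k0 *.
have a1 : 0 < a + 1 by rewrite addr_gt0.
rewrite -addrA lerD2l -subr_ge0.
have -> : - (a + 1)^-1 - (- a^-1 + (a + 1) ^- 2) = (a * (a + 1) ^+ 2)^-1.
  by field; rewrite !gt_eqF.
by rewrite invr_ge0 mulr_ge0 ?exprn_ge0 ?ltW.
Qed.

End Cx.

(** * Analytic continuation of sum xi^m m^(-s) *)

Section Cx.
Variable R : realType.
Local Notation C := R[i].
Local Notation cabs := (@Normc.normc R).
Local Notation Re := (@complex.Re R).
Local Notation Im := (@complex.Im R).
Implicit Types (i J N n m : nat) (s w h l : C) (u : nat -> C).

Definition ccvg u l := forall e : R, 0 < e -> exists N0 : nat, forall N, (N0 <= N)%N ->
  cabs (u N - l) < e.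

Lemma ccvg_cst l : ccvg (fun=> l) l.
Proof. by move=> e e0; exists 0%N => N _; rewrite subrr cabs0. Qed.

Lemma ccvgD u v l k : ccvg u l -> ccvg v k -> ccvg (fun N => u N + v N) (l + k).
Proof.
move=> ul vk e e0; have e2 : 0 < e / 2 by rewrite divr_gt0.
have [N1 H1] := ul _ e2; have [N2 H2] := vk _ e2; exists (maxn N1 N2) => N.
rewrite geq_max => /andP[/H1 h1 /H2 h2]; rewrite opprD addrACA.
by apply: le_lt_trans (cabsD _ _) _; rewrite (splitr e) ltrD.
Qed.

Lemma ccvgZ (c : C) u l : ccvg u l -> ccvg (fun N => c * u N) (c * l).
Proof.
move=> ul e e0; have c0 : 0 < cabs c + 1 by rewrite ltr_wpDl// cabs_ge0.
have [N0 H] := ul _ (divr_gt0 e0 c0); exists N0 => N /H.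
rewrite ltr_pdivlMr// -mulrBr cabsM => h; apply: le_lt_trans h.
by rewrite mulrC ler_wpM2l ?cabs_ge0// lerDl.
Qed.

Lemma ccvg_bound u l (B : R) : ccvg u l -> (forall N, cabs (u N) <= B) -> cabs l <= B.
Proof.
move=> ul uB; apply/ler_addgt0Pl => e e0; have [N /(_ N (leqnn _)) h] := ul e e0.
rewrite cabs_distC in h; rewrite -[l](subrK (u N)).
by apply: le_trans (cabsD _ _) _; apply: lerD; [exact: ltW|exact: uB].
Qed.

Lemma ccvg_unique u l k : ccvg u l -> ccvg u k -> l = k.
Proof.
move=> ul uk; apply/eqP; rewrite -subr_eq0 -cabs_eq0 eq_le cabs_ge0 andbT.
have := ccvgD ul (ccvgZ (-1) uk); rewrite mulN1r => /ccvg_bound; apply => N.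
by rewrite mulN1r subrr cabs0.
Qed.

Lemma ccvg_eq u v l : ccvg u l -> ccvg (fun N => v N - u N) 0 -> ccvg v l.
Proof.
move=> ul vu; have := ccvgD ul vu; rewrite addr0.
by congr ccvg; apply/funext => N; rewrite addrC subrK.
Qed.

Lemma real_series_dominated (v b : nat -> R) (B : R) :
  (forall m, `|v m| <= b m) -> (forall n, \sum_(m < n) b m <= B) ->
  exists l : R, forall e : R, 0 < e -> exists N0 : nat, forall N, (N0 <= N)%N ->
    `|\sum_(m < N) v m - l| < e.
Proof.
move=> vb bB.
have cb : cvgn (series b).
  apply: nondecreasing_is_cvgn.
    apply/nondecreasing_seqP => n; rewrite /series /= big_nat_recr//= lerDl.
    exact: le_trans (vb n).
  by exists B => _ [n _ <-]; rewrite /series /= big_mkord.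
have cn : cvgn [normed series v].
  by apply: (series_le_cvg _ _ vb cb) => n //=; exact: le_trans (vb n).
have := normed_cvg cn => /cvg_ex[l /= vl]; exists l => e e0.
move/cvgrPdist_lt : vl => /(_ e e0)[N0 _ H]; exists N0 => N NN.
by rewrite distrC -(big_mkord xpredT v); exact: H.
Qed.

Lemma series_dominated u (b : nat -> R) (B : R) :
  (forall m, cabs (u m) <= b m) -> (forall n, \sum_(m < n) b m <= B) ->
  exists l, ccvg (fun n => \sum_(m < n) u m) l.
Proof.
move=> ub bB.
have [|l1 H1] := @real_series_dominated (fun m => Re (u m)) b B _ bB.
  by move=> m; exact: le_trans (Re_le_cabs _) (ub m).
have [|l2 H2] := @real_series_dominated (fun m => Im (u m)) b B _ bB.
  by move=> m; exact: le_trans (Im_le_cabs _) (ub m).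
exists (l1 +i* l2) => e e0; have e2 : 0 < e / 2 by rewrite divr_gt0.
have [N1 {}H1] := H1 _ e2; have [N2 {}H2] := H2 _ e2; exists (maxn N1 N2) => N.
rewrite geq_max => /andP[/H1 h1 /H2 h2].
have -> : \sum_(m < N) u m - l1 +i* l2 =
   (\sum_(m < N) Re (u m) - l1) +i* (\sum_(m < N) Im (u m) - l2).
  rewrite (_ : \sum_(m < N) u m = (\sum_(m < N) Re (u m)) +i* (\sum_(m < N) Im (u m)))//.
  elim: (N) => [|k IH]; first by rewrite !big_ord0.
  by rewrite !big_ord_recr IH /=; case: (u k).
apply: le_lt_trans (cabs_le_ReIm _ _) _; rewrite (splitr e); exact: ltrD.
Qed.

Section Xi.
Variable xi : C.
Hypotheses (xi_abs : cabs xi = 1) (xi1 : xi != 1).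
Let eta := xi / (1 - xi).

Let xi1' : 1 - xi != 0. Proof. by rewrite subr_eq0 eq_sym. Qed.

(** J summations by parts turn the partial sum of sum xi^m (ln m)^i m^(-s)
    into this expression, up to boundary terms that vanish in the limit where
    the series converges.  Contrary to the partial sums, these expressions
    converge for Re s > 2 - J. *)
Definition reg_sum i J N s : C :=
  \sum_(j < J) eta ^+ j.+1 * diff_logpow i s j 1 +
  eta ^+ J * \sum_(m < N) xi ^+ m.+1 * diff_logpow i s J (m%:R + 1).

Lemma summation_by_parts (a : R -> C) N :
  \sum_(m < N) xi ^+ m.+1 * a (m%:R + 1) =
  eta * a 1 - eta * xi ^+ N * a (N%:R + 1)
  + eta * \sum_(m < N) xi ^+ m.+1 * fdiff a (m%:R + 1).
Proof.
elim: N => [|N IH]; first by rewrite !big_ord0 add0r expr0 mulr1 subrr mulr0 addr0.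
rewrite !big_ord_recr /= IH /fdiff -(@natr1 _ N) !exprS.
set A := \sum_(m < N) _; rewrite /eta; field; exact: xi1'.
Qed.

Lemma reg_sum_step i J N s :
  reg_sum i J.+1 N s - reg_sum i J N s = eta ^+ J.+1 * xi ^+ N * diff_logpow i s J (N%:R + 1).
Proof.
rewrite /reg_sum big_ord_recr (summation_by_parts (diff_logpow i s J)) exprS /diff_logpow /=.
by ring.
Qed.

Let term_bound i J (M : R) : M + 3 <= J%:R -> exists K : R, 0 <= K /\ forall s, cabs s <= M ->
  forall m, cabs (xi ^+ m.+1 * diff_logpow i s J (m%:R + 1)) <= K * expR (- 2 * ln (m%:R + 1)).
Proof.
move=> MJ; have [K [K0 HK]] := @diff_logpow_bound R J i M; exists K; split=> // s sM m.
rewrite cabsM cabsX xi_abs expr1n mul1r.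
have m1 : 1 <= m%:R + 1 :> R by rewrite lerDr.
apply: le_trans (HK s sM _ m1) _; rewrite ler_wpM2l// ler_expR ler_wpM2r ?ln_ge0//.
have := le_trans (Re_le_cabs s) sM; rewrite ler_norml => /andP[h _]; lra.
Qed.

(** This bound is uniform in N, so that it passes to the limit in the Taylor
    estimate below. *)
Lemma reg_sum_bound i J (M : R) : M + 3 <= J%:R -> exists B : R, forall s, cabs s <= M ->
  forall N, cabs (reg_sum i J N s) <= B.
Proof.
move=> MJ; have [K [K0 HK]] := term_bound i MJ.
have /choice[k Hk] : forall j, exists K : R, forall s, cabs s <= M -> cabs (diff_logpow i s j 1) <= K.
  move=> j; have [k [k0 Hk]] := @diff_logpow_bound R j i M; exists k => s sM.
  by have := Hk s sM 1 (lexx _); rewrite ln1 mulr0 expR0 mulr1.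
exists (\sum_(j < J) cabs eta ^+ j.+1 * k j + cabs eta ^+ J * (K * 2)) => s sM N.
have cabs_sum (n : nat) (F : nat -> C) : cabs (\sum_(j < n) F j) <= \sum_(j < n) cabs (F j).
  elim: n => [|n IH]; first by rewrite !big_ord0 cabs0.
  by rewrite !big_ord_recr /=; apply: le_trans (cabsD _ _) _; rewrite lerD2r.
apply: le_trans (cabsD _ _) _; apply: lerD.
  apply: le_trans (cabs_sum J (fun j => eta ^+ j.+1 * diff_logpow i s j 1)) _; apply: ler_sum => j _.
  by rewrite cabsM cabsX ler_wpM2l ?exprn_ge0 ?cabs_ge0// Hk.
rewrite cabsM cabsX ler_wpM2l ?exprn_ge0 ?cabs_ge0//.
apply: le_trans (cabs_sum N (fun m => xi ^+ m.+1 * diff_logpow i s J (m%:R + 1))) _.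
apply: (@le_trans _ _ (\sum_(m < N) K * expR (- 2 * ln (m%:R + 1)))).
  by apply: ler_sum => m _; exact: HK.
by rewrite -mulr_sumr ler_wpM2l// sum_inv_sqr.
Qed.

Lemma reg_sum_cvg i J s : cabs s + 3 <= J%:R -> exists l, ccvg (fun N => reg_sum i J N s) l.
Proof.
move=> sJ; have [K [K0 HK]] := term_bound i sJ.
have [|l Hl] := @series_dominated (fun m => xi ^+ m.+1 * diff_logpow i s J (m%:R + 1)) _ (K * 2) (HK s (lexx _)).
  by move=> n; rewrite -mulr_sumr ler_wpM2l// sum_inv_sqr.
exists (\sum_(j < J) eta ^+ j.+1 * diff_logpow i s j 1 + eta ^+ J * l).
exact: ccvgD (ccvg_cst _) (ccvgZ _ Hl).
Qed.

Lemma cderiv_reg_sum i J N s h t :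
  cderiv (fun t => reg_sum i J N (s + t%:C * h)) t (- h * reg_sum i.+1 J N (s + t%:C * h)).
Proof.
rewrite /reg_sum.
have -> : - h * (\sum_(j < J) eta ^+ j.+1 * diff_logpow i.+1 (s + t%:C * h) j 1 +
    eta ^+ J * (\sum_(m < N) xi ^+ m.+1 * diff_logpow i.+1 (s + t%:C * h) J (m%:R + 1))) =
   \sum_(j < J) eta ^+ j.+1 * (- h * diff_logpow i.+1 (s + t%:C * h) j 1) +
    eta ^+ J * (\sum_(m < N) xi ^+ m.+1 * (- h * diff_logpow i.+1 (s + t%:C * h) J (m%:R + 1))).
  rewrite mulrDr (mulrCA (- h) (eta ^+ J)) !mulr_sumr; congr (_ + _).
    by apply: eq_bigr => j _; ring.
  by apply: eq_bigr => j _; ring.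
apply: cderivD; last apply: cderivZ; apply: cderiv_sum => j; apply: cderivZ;
  exact: cderiv_diff_logpow_par.
Qed.

(** A Taylor estimate of order two in s.  It is uniform in N, which makes the
    limit in N complex differentiable without any theorem on limits of
    holomorphic functions. *)
Lemma reg_sum_taylor i J s : cabs s + 4 <= J%:R -> exists B : R, forall h, cabs h <= 1 ->
  forall N, cabs (reg_sum i J N (s + h) - reg_sum i J N s + h * reg_sum i.+1 J N s) <= B * cabs h ^+ 2.
Proof.
move=> sJ; have [|B HB] := @reg_sum_bound i.+2 J (cabs s + 1); first by lra.
(* two mean value inequalities, each with a factor 2 *)
exists (4 * B) => h h1 N.
have nb t : 0 <= t <= 1 -> cabs (reg_sum i.+2 J N (s + t%:C * h)) <= B.
  move=> /andP[t0 t1]; apply: HB; apply: le_trans (cabsD _ _) _; rewrite lerD2l cabsM.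
  by rewrite cabs_real ger0_norm// mulr_ile1// cabs_ge0.
have B0 : 0 <= B by apply: le_trans (cabs_ge0 _) (nb 0 _); rewrite lexx ler01.
pose p1 t := reg_sum i.+1 J N (s + t%:C * h).
have d1 t : 0 <= t <= 1 -> cabs (p1 t - p1 0) <= 2 * (cabs h * B).
  move=> /andP[t0 t1].
  have := @cderiv_increment R p1 (fun t => - h * reg_sum i.+2 J N (s + t%:C * h)) 0 t (cabs h * B) t0.
  move=> /(_ _ _)/le_trans; apply.
  - by move=> y _; exact: cderiv_reg_sum.
  - move=> y /andP[y0 yt]; rewrite cabsM cabsN ler_wpM2l ?cabs_ge0// nb//.
    by rewrite y0 (le_trans yt t1).
  by rewrite subr0 ler_piMr// mulr_ge0// mulr_ge0// cabs_ge0.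
pose G t := reg_sum i J N (s + t%:C * h) + t%:C * (h * reg_sum i.+1 J N s).
have dG t : cderiv G t (- h * p1 t + h * reg_sum i.+1 J N s).
  apply: cderivD; first exact: cderiv_reg_sum.
  have := @cderivZ R (h * reg_sum i.+1 J N s) (fun t => t%:C) t 1.
  rewrite mulr1 (_ : (fun x => h * _ * _) = fun t : R => t%:C * (h * reg_sum i.+1 J N s)); last first.
    by apply/funext => y; rewrite mulrC.
  by apply; split; [exact: is_derive_id|exact: is_derive_cst].
have -> : reg_sum i J N (s + h) - reg_sum i J N s + h * reg_sum i.+1 J N s = G 1 - G 0.
  by rewrite /G -[1%:C]/(1 : C) -[0%:C]/(0 : C) !mul0r !mul1r !addr0 addrAC.
have := @cderiv_increment R G _ 0 1 (2 * (cabs h ^+ 2 * B)) ler01 (fun t _ => dG t).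
rewrite subr0 mulr1 (_ : 4 * B * _ = 2 * (2 * (cabs h ^+ 2 * B))); last by ring.
apply => t t01; have -> : - h * p1 t + h * reg_sum i.+1 J N s = - h * (p1 t - p1 0).
  by rewrite /p1 -[0%:C]/(0 : C) mul0r addr0; ring.
rewrite cabsM cabsN expr2 -mulrA mulrCA ler_wpM2l ?cabs_ge0//; exact: d1.
Qed.

(** The continuation of sum xi^m m^(-s).  The number J of summations by parts
    depends on s; by periodic_zetaP its choice is immaterial, hence near a
    given s the same J can be used. *)
Definition periodic_zeta s : C :=
  xget 0 [set l | ccvg (fun N => reg_sum 0 (Num.bound (cabs s + 3)) N s) l].

Lemma periodic_zetaP J s : cabs s + 3 <= J%:R -> ccvg (fun N => reg_sum 0 J N s) (periodic_zeta s).
Proof.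
move=> sJ; pose J0 := Num.bound (cabs s + 3).
have J03 : cabs s + 3 <= J0%:R.
  by apply/ltW/archi_boundP; rewrite addr_ge0// cabs_ge0.
have H0 : ccvg (fun N => reg_sum 0 J0 N s) (periodic_zeta s).
  by have [l Hl] := reg_sum_cvg 0 J03; rewrite /periodic_zeta; case: xgetP => [? -> //|/(_ l)].
have step J' l : cabs s + 3 <= J'%:R -> ccvg (fun N => reg_sum 0 J'.+1 N s - reg_sum 0 J' N s) 0.
  move=> sJ' e e0.
  have c0 : 0 < cabs eta ^+ J'.+1 + 1 by rewrite ltr_wpDl// exprn_ge0// cabs_ge0.
  have [|N0 H] := @diff_logpow_cvg0 R 0 s J' _ _ (divr_gt0 e0 c0).
    by have := Re_le_cabs s; rewrite ler_norml => /andP[h _]; lra.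
  exists N0 => N /H; rewrite ltr_pdivlMr// => h; rewrite subr0 reg_sum_step.
  rewrite !cabsM !cabsX xi_abs expr1n mulr1; apply: le_lt_trans h.
  by rewrite mulrC ler_wpM2l ?cabs_ge0// lerDl.
have up k J' l : cabs s + 3 <= J'%:R -> ccvg (fun N => reg_sum 0 J' N s) l ->
    ccvg (fun N => reg_sum 0 (k + J') N s) l.
  move=> sJ' H; elim: k => // k IH; rewrite addSn; apply: (ccvg_eq IH).
  apply: step => //; apply: le_trans sJ' _; by rewrite ler_nat leq_addl.
have [JJ|JJ] := leqP J0 J; first by rewrite -(subnK JJ); exact: up.
have [l Hl] := reg_sum_cvg 0 sJ.
have := up (J0 - J)%N _ _ sJ Hl; rewrite subnK ?(ltnW JJ)// => H1.
by rewrite (ccvg_unique H0 H1).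
Qed.

Lemma periodic_zeta_entire : entire periodic_zeta.
Proof.
move=> s; pose J := Num.bound (cabs s + 4).
have J4 : cabs s + 4 <= J%:R.
  by apply/ltW/archi_boundP; rewrite addr_ge0// cabs_ge0.
have [B HB] := reg_sum_taylor 0 J4.
have [|l Hl] := @reg_sum_cvg 1 J s; first by lra.
apply: (@cdiff_derivable _ _ _ (- l)) => e e0.
have B1 : 0 < `|B| + 1 by rewrite ltr_wpDl.
exists (Num.min 1 (e / (`|B| + 1))); first by rewrite lt_min ltr01 divr_gt0.
move=> h; rewrite lt_min => /andP[/ltW h1]; rewrite ltr_pdivlMr// => he.
have c1 : ccvg (fun N => reg_sum 0 J N (s + h)) (periodic_zeta (s + h)).
  by apply: periodic_zetaP; have := cabsD s h; lra.
have c2 : ccvg (fun N => reg_sum 0 J N s) (periodic_zeta s) by apply: periodic_zetaP; lra.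
have := ccvgD (ccvgD c1 (ccvgZ (-1) c2)) (ccvgZ h Hl).
rewrite mulN1r -[h * l]opprK -mulrN (mulrC h) => /ccvg_bound H.
apply: (@le_trans _ _ (B * cabs h ^+ 2)).
  by apply: H => N; rewrite mulN1r; exact: HB.
rewrite expr2 mulrA ler_wpM2r ?cabs_ge0//; apply: le_trans (ltW he).
rewrite mulrC ler_wpM2l ?cabs_ge0//; apply: le_trans (ler_norm _) _.
by rewrite lerDl.
Qed.

Lemma periodic_zeta_series s : 1 < Re s ->
  ccvg (fun N => \sum_(m < N) xi ^+ m.+1 * npowN m.+1 s) (periodic_zeta s).
Proof.
move=> s1.
have E N : \sum_(m < N) xi ^+ m.+1 * npowN m.+1 s = reg_sum 0 0 N s.
  rewrite /reg_sum big_ord0 add0r expr0 mul1r; apply: eq_bigr => m _.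
  by rewrite npowNE /diff_logpow /= /pow_cexpN expr0 mul1r natr1.
rewrite (_ : (fun N => _) = (fun N => reg_sum 0 0 N s)); last by apply/funext => N.
have c J : ccvg (fun N => reg_sum 0 0 N s - reg_sum 0 J N s) 0.
  elim: J => [|J IH].
    by rewrite (_ : (fun N => _) = fun=> 0); [exact: ccvg_cst|apply/funext => N; rewrite subrr].
  have : ccvg (fun N => reg_sum 0 J.+1 N s - reg_sum 0 J N s) 0.
    move=> e e0.
    have c0 : 0 < cabs eta ^+ J.+1 + 1 by rewrite ltr_wpDl// exprn_ge0// cabs_ge0.
    have [|N0 H] := @diff_logpow_cvg0 R 0 s J _ _ (divr_gt0 e0 c0).
      by have : 0 <= J%:R :> R by []; lra.
    exists N0 => N /H; rewrite ltr_pdivlMr// => h; rewrite subr0 reg_sum_step.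
    rewrite !cabsM !cabsX xi_abs expr1n mulr1; apply: le_lt_trans h.
    by rewrite mulrC ler_wpM2l ?cabs_ge0// lerDl.
  move=> /(ccvgZ (-1)) /(ccvgD IH); rewrite mulr0 addr0; congr ccvg.
  by apply/funext => N; ring.
apply: (ccvg_eq (@periodic_zetaP (Num.bound (cabs s + 3)) s _) (c _)).
by apply/ltW/archi_boundP; rewrite addr_ge0// cabs_ge0.
Qed.

End Xi.
End Cx.

(** * Values of the polylogarithm at negative integers *)

Section Negative.
Variable F : fieldType.
Implicit Types (a b : nat -> F) (w z : F) (i j l m n k : nat).

Definition ndiff a m : F := a m.+1 - a m.

(** The regularised value of sum_{m >= 0} w^(m+1) a(m) for a polynomial
    sequence a, obtained by summation by parts until the differences vanish. *)
Definition newton_sum w n a : F := \sum_(j < n) (w / (1 - w)) ^+ j.+1 * iter j ndiff a 0%N.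

Definition shifted_pow l m : F := m.+1%:R ^+ l.

(** Li_{-l}(w) as a rational function of w. *)
Definition polylog_neg w l : F := newton_sum w l.+1 (shifted_pow l).

Lemma iter_ndiff_sum (I : Type) (r : seq I) (c : I -> F) (a : I -> nat -> F) j m :
  iter j ndiff (fun m => \sum_(i <- r) c i * a i m) m = \sum_(i <- r) c i * iter j ndiff (a i) m.
Proof.
elim: j m => // j IH m; rewrite !iterS /ndiff !IH -sumrB.
by apply: eq_bigr => i _; rewrite -mulrBr.
Qed.

Lemma eq_newton_sum w n a b : a =1 b -> newton_sum w n a = newton_sum w n b.
Proof. by move=> ab; congr newton_sum; apply/funext. Qed.

Lemma newton_sum_linear (I : Type) (r : seq I) (c : I -> F) (a : I -> nat -> F) w n :
  newton_sum w n (fun m => \sum_(i <- r) c i * a i m) = \sum_(i <- r) c i * newton_sum w n (a i).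
Proof.
rewrite /newton_sum; under eq_bigr do rewrite iter_ndiff_sum mulr_sumr.
rewrite exchange_big; apply: eq_bigr => i _; rewrite mulr_sumr.
by apply: eq_bigr => j _; rewrite mulrCA.
Qed.

Lemma ndiff_shifted_pow l m : ndiff (shifted_pow l) m = \sum_(i < l) 'C(l, i)%:R * shifted_pow i m.
Proof.
rewrite /ndiff /shifted_pow -(@natr1 _ m.+1) (addrC _ 1) exprDn big_ord_recr /= binn mulr1n.
rewrite subnn mul1r addrK; apply: eq_bigr => i _.
by rewrite expr1n mul1r mulr_natl.
Qed.

Lemma iter_ndiff_shifted_pow l j m : (l < j)%N -> iter j ndiff (shifted_pow l) m = 0.
Proof.
elim/ltn_ind: l j m => l IH [//|j] m lj; rewrite iterSr.
rewrite (_ : ndiff (shifted_pow l) = fun m => \sum_(i < l) 'C(l, i)%:R * shifted_pow i m); last first.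
  by apply/funext => k; exact: ndiff_shifted_pow.
rewrite iter_ndiff_sum big1// => i _; rewrite IH ?mulr0//.
exact: leq_trans (ltn_ord i) _.
Qed.

Lemma newton_sum_shifted_pow w l n : (l < n)%N -> newton_sum w n (shifted_pow l) = polylog_neg w l.
Proof.
move=> ln; rewrite /polylog_neg -(subnK ln); elim: (n - l.+1)%N => // k IH.
rewrite addSn /newton_sum big_ord_recr /= iter_ndiff_shifted_pow ?mulr0 ?addr0//.
by rewrite addnS ltnS leq_addl.
Qed.

(** The formal identity sum_{m>=0} w^(m+1) a(m) = w a(0) + w sum_{m>=0}
    w^(m+1) a(m+1) survives regularisation. *)
Lemma newton_sum_step w n a : 1 - w != 0 -> iter n ndiff a 0%N = 0 ->
  newton_sum w n a = w * a 0%N + w * newton_sum w n (fun m => a m.+1).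
Proof.
move=> w1 an.
have E : newton_sum w n.+1 a = w / (1 - w) * a 0%N + w / (1 - w) * newton_sum w n (ndiff a).
  rewrite /newton_sum big_ord_recl /= expr1; congr (_ + _); rewrite mulr_sumr.
  by apply: eq_bigr => j _; rewrite -iterSr [in RHS]mulrA -exprS.
have E' : newton_sum w n (fun m => a m.+1) = newton_sum w n a + newton_sum w n (ndiff a).
  rewrite /newton_sum -big_split; apply: eq_bigr => j _ /=; rewrite -mulrDr; congr (_ * _).
  rewrite -iterSr iterS /ndiff addrCA subrr addr0.
  by elim: (nat_of_ord j) (0%N) => // k IH m; rewrite !iterS /ndiff !IH.
rewrite E' mulrDr.
have : newton_sum w n.+1 a = newton_sum w n a by rewrite /newton_sum big_ord_recr /= an mulr0 addr0.
move: E => -> E; have {E} : w * a 0%N + w * newton_sum w n (ndiff a) = (1 - w) * newton_sum w n a.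
  by rewrite -E; field.
by rewrite mulrBl mul1r => E; rewrite [X in _ = _ + X]addrC addrA E subrK.
Qed.

(** The rational function sum_{b >= 0} b^l z^b, written by means of the
    inversion formula of the polylogarithm. *)
Definition geom_moment z l : F := (-1) ^+ l.+1 * polylog_neg z^-1 l.

(** The step relation for the sequence m^k at w = 1/z, in which m = (m + 1) -
    1 is expanded by the binomial theorem so that only shifted powers occur. *)
Lemma geom_moment_rec z k : z != 0 -> z != 1 ->
  (1 - z) * geom_moment z k = (k == 0%N)%:R + z * \sum_(l < k) 'C(k, l)%:R * geom_moment z l.
Proof.
move=> z0 z1.
have w1 : 1 - z^-1 != 0 by rewrite subr_eq0 eq_sym invr_eq1.
have sgn (a b : nat) : (b <= a)%N -> (-1) ^+ (a - b) = (-1) ^+ a.+1 * (-1) ^+ b.+1 :> F.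
  move=> ba; have E : ((a - b) + b.+1)%N = a.+1 by rewrite addnS subnK.
  by rewrite -E exprD -mulrA -expr2 sqrr_sign mulr1.
have powE m : m%:R ^+ k = \sum_(l < k.+1) ((-1) ^+ (k - l) * 'C(k, l)%:R) * shifted_pow l m.
  rewrite -[m%:R](addrK 1) natr1 (addrC _ (-1)) exprDn; apply: eq_bigr => l _.
  by rewrite -mulrnAl -[_ *+ 'C(_, _)]mulr_natr.
have ak : iter k.+1 ndiff (fun m => m%:R ^+ k) 0%N = 0.
  rewrite (_ : (fun m => _) = fun m => \sum_(l < k.+1) ((-1) ^+ (k - l) * 'C(k, l)%:R) * shifted_pow l m); last first.
    by apply/funext => m; exact: powE.
  by rewrite iter_ndiff_sum big1// => l _; rewrite iter_ndiff_shifted_pow ?mulr0.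
have := newton_sum_step w1 ak.
rewrite (eq_newton_sum _ _ powE) newton_sum_linear expr0n -[newton_sum _ _ (fun m => _)]/(polylog_neg z^-1 k).
have -> : \sum_(i < k.+1) (-1) ^+ (k - i) * 'C(k, i)%:R * newton_sum z^-1 k.+1 (shifted_pow i) =
    (-1) ^+ k.+1 * \sum_(l < k.+1) 'C(k, l)%:R * geom_moment z l.
  rewrite mulr_sumr; apply: eq_bigr => l _; rewrite newton_sum_shifted_pow//.
  have lk : (l <= k)%N by rewrite -ltnS; exact: ltn_ord.
  rewrite (sgn _ _ lk).
  by rewrite /geom_moment; ring.
move=> /(congr1 ( *%R (z * (-1) ^+ k.+1))).
rewrite -[z * (-1) ^+ k.+1 * (_ * _)]mulrA (mulrA ((-1) ^+ k.+1)) -expr2 sqrr_sign mul1r.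
rewrite mulrDr ![_ * (-1) ^+ k.+1 * (_ * _)]mulrACA divff// !mul1r -/(geom_moment z k).
have -> : (-1) ^+ k.+1 * (k == 0%N)%:R = - (k == 0%N)%:R :> F.
  by case: k {powE ak} => [|k]; rewrite ?expr1 ?mulN1r// mulr0 oppr0.
rewrite big_ord_recr /= binn mul1r mulrDr mulrBl mul1r => E.
apply/eqP; rewrite subr_eq -addrA E addrA subrr add0r.
by [].
Qed.

End Negative.

Lemma polylog_neg_rmorph (F G : fieldType) (f : {rmorphism F -> G}) w l :
  f (polylog_neg w l) = polylog_neg (f w) l.
Proof.
rewrite /polylog_neg /newton_sum rmorph_sum; apply: eq_bigr => j _.
rewrite rmorphM rmorphXn fmorph_div rmorphB rmorph1; congr (_ * _).
have -> m : f (iter j (@ndiff F) (@shifted_pow F l) m) = iter j (@ndiff G) (@shifted_pow G l) m.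
  elim: (nat_of_ord j) m => [|k IH] m; first by rewrite /= /shifted_pow rmorphXn rmorph_nat.
  by rewrite !iterS /ndiff rmorphB !IH.
by [].
Qed.

(** * Values of the continued zeta function *)

Section Cx.
Variable R : realType.
Local Notation C := R[i].
Local Notation cabs := (@Normc.normc R).
Local Notation Re := (@complex.Re R).
Local Notation Im := (@complex.Im R).

Lemma ccvg_cvg (u : nat -> C) l : ccvg u l -> u @ \oo --> (l : C^o).
Proof.
move=> ul; apply: (iffRL (@cvgrPdist_lt _ C^o _ _ _ u l)) => e e0.
have eE : e = (Re e)%:C by move: e0; case: (e) => a b; rewrite ltcE /= => /andP[/eqP -> _].
have re0 : 0 < Re e by rewrite -ltcR -eE.
have [N0 H] := ul _ re0; exists N0 => // N /= /H.
by rewrite cabs_norm eE ltcR cabs_distC.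
Qed.

Lemma diff_logpow_neg l j m : diff_logpow 0 (- l%:R) j (m%:R + 1) = iter j (@ndiff C) (@shifted_pow C l) m.
Proof.
elim: j m => [|j IH] m; last by have := IH m.+1; rewrite -natr1 diff_logpowS IH => ->.
rewrite /diff_logpow /= /pow_cexpN expr0 mul1r -(rmorph_nat (real_complex R)) -rmorphN /= natr1.
rewrite mulNr opprK mul0r cos0 sin0 mulr1 mulr0 oppr0 expRM_natl lnK ?posrE//.
by rewrite complexr0 /shifted_pow rmorphXn rmorph_nat.
Qed.

(** For J > l the J-th differences of m^l vanish, so the regularised sums do
    not depend on N. *)
Lemma zeta1_neg (xi : C) l : cabs xi = 1 -> xi != 1 -> zeta1 xi (- l%:R) = polylog_neg xi l.
Proof.
move=> xi_abs xi1.
have dir s : 1 < Re s -> [series xi ^+ m.+1 * npowN m.+1 s]_m @ \oo --> (periodic_zeta xi s : C^o).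
  move=> s1; have := ccvg_cvg (periodic_zeta_series xi_abs xi1 s1).
  rewrite (_ : (fun N => _) = [series xi ^+ m.+1 * npowN m.+1 s]_m)//.
  by apply/funext => N; rewrite /series /= big_mkord.
have -> : zeta1 xi = periodic_zeta xi.
  rewrite /zeta1; case: xgetP => [f _ [ef Hf]|/(_ (periodic_zeta xi))]; last first.
    by case; split; [exact: periodic_zeta_entire|exact: dir].
  apply: (entire_unique ef (periodic_zeta_entire xi_abs xi1)) => s s1.
  by apply: (cvg_unique (@norm_hausdorff _ C^o) (Hf s s1) (dir s s1)).
pose J := maxn (Num.bound (cabs (- l%:R : C) + 3)) l.+1.
have J3 : cabs (- l%:R : C) + 3 <= J%:R.
  apply: (@le_trans _ _ (Num.bound (cabs (- l%:R : C) + 3))%:R); last by rewrite ler_nat leq_maxl.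
  by apply/ltW/archi_boundP; rewrite addr_ge0// cabs_ge0.
apply: (ccvg_unique (periodic_zetaP xi_abs xi1 J3)).
rewrite (_ : (fun N => _) = fun=> polylog_neg xi l); first exact: ccvg_cst.
apply/funext => N; rewrite -(@newton_sum_shifted_pow _ xi l J) ?leq_maxr// /reg_sum.
rewrite [X in _ + _ * X]big1 => [|m _]; last first.
  by rewrite diff_logpow_neg iter_ndiff_shifted_pow ?mulr0// leq_maxr.
rewrite mulr0 addr0; apply: eq_bigr => j _.
by have := diff_logpow_neg l j 0; rewrite add0r => ->.
Qed.

Lemma alg_of_polylog (iotaC : {rmorphism algC -> C}) (c l : nat) (w : algC) :
  (0 < c)%N -> w ^+ c = 1 -> w != 1 ->
  alg_of iotaC (zeta1 (iotaC w) (- l%:R)) = polylog_neg w l.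
Proof.
move=> c0 wc w1; rewrite zeta1_neg -?polylog_neg_rmorph.
- rewrite /alg_of; case: xgetP => [a _ /= /fmorph_inj//|/(_ (polylog_neg w l))]/=.
  by case.
- apply/eqP; rewrite -(@eqrXn2 _ c)// ?cabs_ge0// -cabsX -rmorphXn wc rmorph1 cabs1.
  by rewrite expr1n.
- by rewrite fmorph_eq1.
Qed.

End Cx.

(** * Elementary p-adic estimates *)

Section Padic.
Variables (R : realType) (p : nat) (K : Cp_field R p).
Hypothesis p_pr : prime p.
Implicit Types (x y z : K) (m n l N L : nat).
Local Notation v := (@pabs R p K).

Let p0 : (0 < p)%N := prime_gt0 p_pr.

Lemma pabs0 : v 0 = 0. Proof. by apply/eqP; rewrite pabs_eq0. Qed.

Lemma pabs_gt0 x : (0 < v x) = (x != 0).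
Proof. by rewrite lt0r pabs_eq0 pabs_ge0 andbT. Qed.

Lemma pabs1 : v 1 = 1.
Proof.
have : v 1 * v 1 = v 1 * 1 by rewrite -pabsM !mulr1.
by apply/mulfI; rewrite pabs_eq0 oner_eq0.
Qed.

Lemma pabsX x n : v (x ^+ n) = v x ^+ n.
Proof. by elim: n => [|n IH]; rewrite ?expr0 ?pabs1// !exprS pabsM IH. Qed.

Lemma pabsN x : v (- x) = v x.
Proof.
have h : v (-1) = 1.
  have : v (-1) ^+ 2 = 1 ^+ 2 by rewrite -pabsX sqrrN !expr1n pabs1.
  by move/eqP; rewrite eqrXn2 ?pabs_ge0// => /eqP.
by rewrite -mulN1r pabsM h mul1r.
Qed.

Lemma pabs_distC x y : v (x - y) = v (y - x).
Proof. by rewrite -pabsN opprB. Qed.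

Lemma pabsV x : v x^-1 = (v x)^-1.
Proof.
have [->|x0] := eqVneq x 0; first by rewrite invr0 pabs0 invr0.
have vx : v x != 0 by rewrite pabs_eq0.
apply: (@mulfI _ (v x)) => //; rewrite -pabsM (divff x0) (divff vx); exact: pabs1.
Qed.

Lemma pabsD_le x y (B : R) : v x <= B -> v y <= B -> v (x + y) <= B.
Proof. by move=> xB yB; apply: le_trans (pabsD _ _) _; rewrite ge_max xB yB. Qed.

Lemma pabsB_le x y (B : R) : v x <= B -> v y <= B -> v (x - y) <= B.
Proof. by move=> xB yB; apply: pabsD_le; rewrite ?pabsN. Qed.

Lemma pabsD_lt x y (B : R) : v x < B -> v y < B -> v (x + y) < B.
Proof. by move=> xB yB; apply: le_lt_trans (pabsD _ _) _; rewrite gt_max xB yB. Qed.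

Lemma pabsB_lt x y (B : R) : v x < B -> v y < B -> v (x - y) < B.
Proof. by move=> xB yB; apply: pabsD_lt; rewrite ?pabsN. Qed.

Lemma pabs_sum_le (I : eqType) (r : seq I) (P : pred I) (F : I -> K) (B : R) : 0 <= B ->
  (forall i, i \in r -> P i -> v (F i) <= B) -> v (\sum_(i <- r | P i) F i) <= B.
Proof.
move=> B0 FB; rewrite big_seq_cond; apply: (big_ind (fun x => v x <= B)).
- by rewrite pabs0.
- by move=> x y; exact: pabsD_le.
- by move=> i /andP[]; exact: FB.
Qed.

Lemma pabs_nat_le1 n : v n%:R <= 1.
Proof.
elim: n => [|n IH]; first by rewrite pabs0.
by rewrite -natr1; apply: pabsD_le => //; rewrite pabs1.
Qed.

(** By Bezout, 1 is a combination of p and n, so n cannot lie in the maximal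
    ideal. *)
Lemma pabs_nat_coprime n : coprime p n -> v n%:R = 1.
Proof.
move=> pn; apply/eqP; rewrite eq_le pabs_nat_le1 /= leNgt; apply/negP => n1.
have [u w E _] := egcdnP n p0; rewrite (eqP pn) in E.
have : v 1 < 1.
  have -> : 1 = u%:R * p%:R - w%:R * n%:R :> K.
    by rewrite -!natrM E natrD addrC addKr.
  have vp : v p%:R < 1 by rewrite pabs_p invf_lt1 ?ltr0n// ltr1n prime_gt1.
  apply: pabsB_lt; rewrite pabsM.
    by apply: le_lt_trans vp; rewrite ler_piMl ?pabs_ge0 ?pabs_nat_le1.
  by apply: le_lt_trans n1; rewrite ler_piMl ?pabs_ge0 ?pabs_nat_le1.
by rewrite pabs1 ltxx.
Qed.

Lemma pabs_natX n : v (p%:R ^+ n) = (p%:R ^+ n)^-1.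
Proof. by rewrite pabsX pabs_p exprVn. Qed.

Lemma natr_neq0 n : (0 < n)%N -> n%:R != 0 :> K.
Proof.
move=> n0; have [m cpm ->] := pfactor_coprime p_pr n0.
rewrite natrM mulf_neq0//.
  by rewrite -pabs_gt0 pabs_nat_coprime// ltr01.
by rewrite -pabs_gt0 natrX pabs_natX invr_gt0 exprn_gt0// ltr0n.
Qed.

Lemma expVp_le m n : (m <= n)%N -> (p%:R ^+ n)^-1 <= (p%:R ^+ m)^-1 :> R.
Proof.
move=> mn; rewrite lef_pV2 ?posrE ?exprn_gt0 ?ltr0n//.
by apply: ler_weXn2l => //; rewrite ler1n.
Qed.

Lemma expVp_ge0 n : 0 <= (p%:R ^+ n)^-1 :> R.
Proof. by rewrite invr_ge0 exprn_ge0. Qed.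

Lemma expVp_cvg0 (e : R) : 0 < e -> exists N, forall n, (N <= n)%N -> (p%:R ^+ n)^-1 < e.
Proof.
move=> e0.
have q1 : `|(p%:R)^-1 : R| < 1.
  by rewrite ger0_norm ?invr_ge0// invf_lt1 ?ltr0n// ltr1n prime_gt1.
have /cvgrPdist_lt/(_ e e0)[N _ H] := cvg_geometric 1 q1.
exists N => n /H; rewrite /= sub0r normrN mul1r exprVn; exact: le_lt_trans (ler_norm _).
Qed.

Section Roots.
Variable c : nat.
Hypothesis pc : ~~ (p %| c)%N.

Let cpc : coprime p c. Proof. by rewrite prime_coprime. Qed.
Let c_gt0 : (0 < c)%N. Proof. by case: c pc => //; rewrite dvdn0. Qed.

Lemma pabs_root z : z ^+ c = 1 -> v z = 1.
Proof.
move=> zc; apply/eqP; rewrite -(@eqrXn2 _ c)// ?pabs_ge0// -pabsX zc pabs1.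
by rewrite expr1n.
Qed.

(** Inverting 1 - z with denominator c only: this makes 1 / (1 - z) a p-adic
    integer, with coordinates in Z[1/c]. *)
Lemma root_inv z : z ^+ c = 1 -> z != 1 ->
  (1 - z) * (- (c%:R^-1) * \sum_(k < c) k%:R * z ^+ k) = 1.
Proof.
move=> zc z1; rewrite mulrCA.
have H n : (1 - z) * \sum_(k < n.+1) k%:R * z ^+ k = \sum_(k < n) z ^+ k.+1 - n%:R * z ^+ n.+1.
  elim: n => [|n IH]; first by rewrite big_ord1 big_ord0 !mul0r mulr0 subrr.
  rewrite big_ord_recr /= mulrDr IH [in RHS]big_ord_recr /= -natr1 !exprS; ring.
have G : \sum_(k < c) z ^+ k = 0.
  have := subrX1 z c; rewrite zc subrr => /esym/eqP; rewrite mulf_eq0 subr_eq0 (negPf z1).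
  by move/eqP.
have -> : (1 - z) * \sum_(k < c) k%:R * z ^+ k = - c%:R.
  case: c c_gt0 zc G => // d _ zc; rewrite big_ord_recl expr0 => G.
  rewrite H zc mulr1; have -> : \sum_(k < d) z ^+ k.+1 = -1.
    by apply/eqP; rewrite -addr_eq0 addrC -[X in _ == X]G; apply/eqP; congr (_ + _).
  by rewrite -natr1 opprD addrC.
by rewrite mulrN mulNr opprK mulVf// natr_neq0.
Qed.

Lemma pabs_sub_root z : z ^+ c = 1 -> z != 1 -> v (1 - z) = 1.
Proof.
move=> zc z1; have vz := pabs_root zc.
apply/eqP; rewrite eq_le; apply/andP; split.
  by apply: pabsB_le; rewrite ?pabs1 ?vz.
have := congr1 v (root_inv zc z1); rewrite pabs1 pabsM => <-.
rewrite ler_piMr ?pabs_ge0// pabsM pabsN pabsV pabs_nat_coprime// invr1 mul1r.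
apply: pabs_sum_le => // k _ _; rewrite pabsM pabsX vz expr1n mulr1.
exact: pabs_nat_le1.
Qed.

(** The integral of b^l against m_z at level N. *)
Definition moment_approx z l N : K := (\sum_(b < p ^ N) b%:R ^+ l * z ^+ b) / (1 - z ^+ (p ^ N)).

Lemma root_powp_neq1 z k : z ^+ c = 1 -> z != 1 -> coprime k c -> z ^+ k != 1.
Proof.
move=> zc z1 kc; apply: contraNneq z1 => zk.
have [u w E _] := egcdnP k c_gt0; rewrite gcdnC (eqP kc) in E.
have : z ^+ (u * c) = 1 by rewrite mulnC exprM zc expr1n.
by rewrite E exprD expr1 mulnC exprM zk expr1n mul1r => ->.
Qed.

(** Summation of z^(b+1) (b+1)^l over b < M in two ways. *)
Lemma power_sum_rec z M l :
  (1 - z) * \sum_(b < M) b%:R ^+ l * z ^+ b =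
  (l == 0%N)%:R - M%:R ^+ l * z ^+ M +
  z * \sum_(i < l) 'C(l, i)%:R * \sum_(b < M) b%:R ^+ i * z ^+ b.
Proof.
elim: M => [|M IH].
  rewrite big_ord0 mulr0 big1 => [|i _]; last by rewrite big_ord0 mulr0.
  by rewrite mulr0 addr0 expr0 mulr1 expr0n subrr.
have -> : \sum_(i < l) 'C(l, i)%:R * \sum_(b < M.+1) b%:R ^+ i * z ^+ b =
   \sum_(i < l) 'C(l, i)%:R * \sum_(b < M) b%:R ^+ i * z ^+ b
   + (M.+1%:R ^+ l - M%:R ^+ l) * z ^+ M.
  rewrite -(@natr1 _ M) (addrC _ 1) exprDn big_ord_recr /= binn mulr1n subnn mul1r addrK.
  rewrite mulr_suml -big_split; apply: eq_bigr => i _ /=.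
  by rewrite big_ord_recr /= expr1n mul1r mulrDr -[M%:R ^+ i *+ _]mulr_natl mulrA.
rewrite big_ord_recr /= mulrDr IH exprS; ring.
Qed.

(** Up to the term p^(N l) z^(p^N), which is small for l > 0, the sums at
    level N satisfy the recurrence of geom_moment; since |1 - z| = 1 the error
    does not grow. *)
Lemma moment_approx_bound z l N : z ^+ c = 1 -> z != 1 ->
  v (geom_moment z l) <= 1 /\ v (moment_approx z l N - geom_moment z l) <= (p%:R ^+ N)^-1.
Proof.
move=> zc z1.
have vz := pabs_root zc.
have z0 : z != 0 by rewrite -pabs_gt0 vz.
have v1z := pabs_sub_root zc z1.
have zN1 : z ^+ (p ^ N) != 1 by apply: root_powp_neq1; rewrite // coprimeXl.
have zNc : (z ^+ (p ^ N)) ^+ c = 1 by rewrite exprAC zc expr1n.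
have v1zN := pabs_sub_root zNc zN1.
have zNn0 : 1 - z ^+ (p ^ N) != 0 by rewrite subr_eq0 eq_sym.
elim/ltn_ind: l => l IH.
have rec := geom_moment_rec l z0 z1.
have rec' : (1 - z) * moment_approx z l N =
  ((l == 0%N)%:R - (p ^ N)%:R ^+ l * z ^+ (p ^ N)) / (1 - z ^+ (p ^ N)) +
  z * \sum_(i < l) 'C(l, i)%:R * moment_approx z i N.
  rewrite /moment_approx mulrA power_sum_rec mulrDl -[in LHS]mulrA; congr (_ + z * _).
  by rewrite mulr_suml; apply: eq_bigr => i _; rewrite mulrA.
split.
  rewrite -[leLHS]mul1r -[X in X * _]v1z -pabsM rec; apply: pabsD_le; first exact: pabs_nat_le1.
  rewrite pabsM vz mul1r; apply: pabs_sum_le => // i _ _.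
  by rewrite pabsM mulr_ile1 ?pabs_ge0 ?pabs_nat_le1//; have [] := IH i (ltn_ord i).
rewrite -[leLHS]mul1r -[X in X * _]v1z -pabsM mulrBr rec rec'.
have -> : forall a b c d : K, a + b - (c + d) = (a - c) + (b - d) by move=> *; ring.
apply: pabsD_le.
  case: l {IH rec rec'} => [|l]; first by rewrite eqxx expr0 mul1r divff// subrr pabs0 expVp_ge0.
  rewrite /= subr0 sub0r mulNr pabsN !pabsM (pabsX z) vz expr1n mulr1 pabsV v1zN invr1 mulr1.
  rewrite pabsX natrX pabs_natX exprS ler_piMr ?expVp_ge0// exprn_ile1 ?expVp_ge0//.
  by have := expVp_le (leq0n N); rewrite expr0 invr1.
rewrite -mulrBr pabsM vz mul1r -sumrB; apply: pabs_sum_le => [|i _ _]; first exact: expVp_ge0.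
rewrite -mulrBr pabsM -[leRHS]mul1r; apply: ler_pM; rewrite ?pabs_ge0 ?pabs_nat_le1//.
by have [] := IH i (ltn_ord i).
Qed.

End Roots.

(** The binomial coefficient of -(k+1) over l, as an integer. *)
Definition negbin k l : K := (-1) ^+ l * 'C(k + l, l)%:R.

Lemma gbinomE k l : gbinom (- k.+1%:R) l = negbin k l.
Proof.
rewrite /gbinom /negbin.
have -> : \prod_(i < l) (- k.+1%:R - i%:R) = (-1) ^+ l * ((k + l) ^_ l)%:R :> K.
  elim: l => [|l IH]; first by rewrite big_ord0 expr0 mul1r ffactn0.
  rewrite big_ord_recr /= IH addnS ffactSS natrM exprS -addnS -natr1 natrD -natr1; ring.
rewrite -bin_ffact natrM mulrA mulfK//; exact/natr_neq0/fact_gt0.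
Qed.

Lemma negbin_le1 k l : v (negbin k l) <= 1.
Proof. by rewrite pabsM pabsX pabsN pabs1 expr1n mul1r pabs_nat_le1. Qed.

Lemma negbinS k l : negbin k.+1 l.+1 + negbin k.+1 l = negbin k l.+1.
Proof. by rewrite /negbin exprS addSnnS addnS binS natrD -addSnnS; ring. Qed.

(** Multiplication by 1 + x lowers the exponent k, by Pascal's rule, at the
    expense of one term of order x^L; the coefficients are integers. *)
Lemma negbinom_approx x k L : v (1 + x) = 1 -> v x <= 1 ->
  v ((1 + x) ^- k.+1 - \sum_(l < L) negbin k l * x ^+ l) <= v x ^+ L.
Proof.
move=> x1 vx; have n0 : 1 + x != 0 by rewrite -pabs_gt0 x1.
have geo M : (1 + x) * \sum_(l < M) negbin 0 l * x ^+ l = 1 - (- x) ^+ M.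
  elim: M => [|M IH]; first by rewrite big_ord0 mulr0 expr0 subrr.
  by rewrite big_ord_recr /= mulrDr IH /negbin add0n binn !(exprNn x) !exprS; ring.
have pas k' M : (1 + x) * \sum_(l < M.+1) negbin k'.+1 l * x ^+ l =
    \sum_(l < M.+1) negbin k' l * x ^+ l + negbin k'.+1 M * x ^+ M.+1.
  elim: M => [|M IH]; first by rewrite !big_ord1 /negbin !bin0 !expr0 expr1; ring.
  rewrite big_ord_recr /= mulrDr IH [in RHS]big_ord_recr /= -(negbinS k' M) !exprS; ring.
elim: k => [|k IH].
  rewrite -[leLHS]mul1r -[X in X * _]x1 -pabsM mulrBr expr1 divff// geo opprB addrC subrK.
  by rewrite pabsX pabsN.
case: L IH => [|L] IH.
  by rewrite big_ord0 subr0 expr0 pabsV pabsX x1 expr1n invr1.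
rewrite -[leLHS]mul1r -[X in X * _]x1 -pabsM mulrBr pas exprS invfM mulVKf// opprD addrA.
by apply: pabsB_le => //; rewrite pabsM -pabsX ler_piMl ?pabs_ge0 ?negbin_le1.
Qed.

End Padic.

(** * The field Q_p(mu_c), integral combinations of roots of unity, Frobenius *)

Section Padic.
Variables (R : realType) (p : nat) (K : Cp_field R p).
Hypothesis p_pr : prime p.
Implicit Types (x y z : K) (m n l N L k : nat).
Local Notation v := (@pabs R p K).

Lemma abs_cvgP (u : nat -> K) (l : K) : abs_cvg v u l <->
  (forall e : R, 0 < e -> exists N, forall n, (N <= n)%N -> v (u n - l) < e).
Proof.
split=> [/cvgrPdist_lt ul e e0|ul].
  have [N _ H] := ul e e0; exists N => n /H.
  by rewrite sub0r normrN ger0_norm// pabs_ge0.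
apply/cvgrPdist_lt => e e0; have [N H] := ul e e0; exists N => // n /= /H.
by rewrite sub0r normrN ger0_norm// pabs_ge0.
Qed.

Lemma abs_cvg_unique (u : nat -> K) (l k : K) : abs_cvg v u l -> abs_cvg v u k -> l = k.
Proof.
move=> /abs_cvgP ul /abs_cvgP uk; apply/eqP; rewrite -subr_eq0 -(@pabs_eq0 _ _ K).
rewrite eq_le pabs_ge0 andbT; apply/ler_addgt0Pl => e e0; rewrite addr0.
have [N1 H1] := ul e e0; have [N2 H2] := uk e e0.
have -> : l - k = (u (maxn N1 N2) - k) - (u (maxn N1 N2) - l) by ring.
by apply/ltW/pabsB_lt; [apply/H2/leq_maxr|apply/H1/leq_maxl].
Qed.

Lemma padic_series (a : nat -> K) : (forall l, v (a l) <= (p%:R ^+ l)^-1) ->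
  exists tau, forall L, v (tau - \sum_(l < L) a l) <= (p%:R ^+ L)^-1.
Proof.
move=> aB; pose u L := \sum_(l < L) a l.
have uB L N : (L <= N)%N -> v (u N - u L) <= (p%:R ^+ L)^-1.
  move=> LN; rewrite -(subnK LN); elim: (N - L)%N => [|d IH].
    by rewrite add0n subrr pabs0 expVp_ge0.
  rewrite addSn {1}/u big_ord_recr /= -/(u _) addrAC; apply: pabsD_le => //.
  by apply: le_trans (aB _) _; apply: expVp_le => //; exact: leq_addl.
have [|tau /abs_cvgP Htau] := @Cp_complete _ _ K u.
  move=> e e0; have [N HN] := expVp_cvg0 p_pr e0; exists N => i j Ni Nj.
  have -> : u i - u j = (u i - u N) - (u j - u N) by ring.
  by apply: le_lt_trans (HN N (leqnn _)); apply: pabsB_le; exact: uB.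
exists tau => L; have pL : 0 < (p%:R ^+ L)^-1 :> R.
  by rewrite invr_gt0 exprn_gt0// ltr0n prime_gt0.
have [N HN] := Htau _ pL; pose M := maxn N L.
have -> : tau - u L = (u M - u L) - (u M - tau) by ring.
by apply: pabsB_le; [apply: uB; exact: leq_maxr|apply/ltW/HN; exact: leq_maxl].
Qed.

Lemma Qp_ratr (a : rat) : Qp (ratr a : K).
Proof. by move=> e e0; exists (ratr a); [exists a|rewrite subrr pabs0]. Qed.

Section Roots.
Variables (c : nat) (iota : {rmorphism algC -> K}).
Hypotheses (pc : ~~ (p %| c)%N) (c_gt0 : (0 < c)%N).

Let phi : {rmorphism rat -> K} := iota \o (@ratr algC).
Let phiE a : phi a = ratr a. Proof. exact: fmorph_rat. Qed.

Lemma Qp_mu_Qp x : Qp x -> Qp_mu c x.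
Proof. by move=> qx S [_ h _]; exact: h. Qed.

Lemma Qp_mu_root x : x ^+ c = 1 -> Qp_mu c x.
Proof. by move=> qx S [_ _ h]; exact: h. Qed.

Lemma Qp_mu_sub x y : Qp_mu c x -> Qp_mu c y -> Qp_mu c (x - y).
Proof.
move=> qx qy S SS; have [[_ h _] _ _] := SS.
by have := h x y (mem_set (qx S SS)) (mem_set (qy S SS)); rewrite inE.
Qed.

Lemma Qp_mu_div x y : Qp_mu c x -> Qp_mu c y -> Qp_mu c (x / y).
Proof.
move=> qx qy S SS; have [[_ _ h] _ _] := SS.
by have := h x y (mem_set (qx S SS)) (mem_set (qy S SS)); rewrite inE.
Qed.

Lemma Qp_mu_ratr a : Qp_mu c (ratr a : K).
Proof. by apply: Qp_mu_Qp; exact: Qp_ratr. Qed.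

Lemma Qp_mu0 : Qp_mu c (0 : K).
Proof. by have := Qp_mu_ratr 0; rewrite -phiE rmorph0. Qed.

Lemma Qp_mu_add x y : Qp_mu c x -> Qp_mu c y -> Qp_mu c (x + y).
Proof.
move=> qx qy; rewrite -[y]opprK -[- y]sub0r; apply: Qp_mu_sub => //.
by apply: Qp_mu_sub => //; exact: Qp_mu0.
Qed.

Lemma Qp_mu_mul x y : Qp_mu c x -> Qp_mu c y -> Qp_mu c (x * y).
Proof.
move=> qx qy; rewrite -[y]invrK -[y^-1]mul1r; apply: Qp_mu_div => //.
by apply: Qp_mu_div => //; apply: Qp_mu_root; rewrite expr1n.
Qed.

Lemma Qp_mu_sum (I : Type) (r : seq I) (F : I -> K) :
  (forall i, Qp_mu c (F i)) -> Qp_mu c (\sum_(i <- r) F i).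
Proof.
by move=> h; apply: (big_ind (Qp_mu c)) => //; [exact: Qp_mu0|exact: Qp_mu_add].
Qed.

Let zetaP : {z : algC | c.-primitive_root z} := C_prim_root_exists c_gt0.
Let zeta : K := iota (sval zetaP).
Let zeta_prim : c.-primitive_root zeta.
Proof. by rewrite fmorph_primitive_root; exact: (svalP zetaP). Qed.

Lemma root_iota x : x ^+ c = 1 -> exists2 w : algC, w ^+ c = 1 & x = iota w.
Proof.
move=> /(prim_rootP zeta_prim)[i ->]; exists (sval zetaP ^+ i).
  by rewrite exprAC (prim_expr_order (svalP zetaP)) expr1n.
by rewrite rmorphXn.
Qed.

(** The ring generated by mu_c over the p-integral rational numbers.  The
    coordinates are rational, and they are what is made to converge in
    Qp_mu_lim. *)
Definition int_span : set K := [set x | exists t : nat -> rat,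
  (forall k, v (ratr (t k)) <= 1) /\ x = \sum_(k < c) ratr (t k) * zeta ^+ k].

Lemma int_span_D x y : int_span x -> int_span y -> int_span (x + y).
Proof.
move=> [t [t1 ->]] [u [u1 ->]]; exists (fun k => t k + u k); split.
  by move=> k; rewrite -phiE rmorphD !phiE; exact: pabsD_le.
rewrite -big_split; apply: eq_bigr => k _ /=.
by rewrite -[ratr (_ + _)]phiE rmorphD !phiE mulrDl.
Qed.

Lemma int_span_mono a k : v (ratr a) <= 1 -> int_span (ratr a * zeta ^+ k).
Proof.
move=> a1; pose k0 := Ordinal (ltn_pmod k c_gt0).
exists (fun j : nat => if j == (k0 : nat) then a else 0); split.
  by move=> j; case: eqP => // _; rewrite -phiE rmorph0 pabs0.
rewrite (bigD1 k0)//= eqxx (prim_expr_mod zeta_prim) big1 ?addr0// => j jk.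
by rewrite (negPf (_ : (j : nat) != k0)) ?(inj_eq val_inj)// -phiE rmorph0 mul0r.
Qed.

Lemma int_span0 : int_span 0.
Proof.
have := @int_span_mono 0 0; rewrite -phiE rmorph0 mul0r; apply.
by rewrite pabs0.
Qed.

Lemma int_span_sum (I : Type) (r : seq I) (F : I -> K) :
  (forall i, int_span (F i)) -> int_span (\sum_(i <- r) F i).
Proof.
by move=> h; apply: (big_ind int_span) => //; [exact: int_span0|exact: int_span_D].
Qed.

Lemma int_span_M x y : int_span x -> int_span y -> int_span (x * y).
Proof.
move=> [t [t1 ->]] [u [u1 ->]]; rewrite mulr_suml; apply: int_span_sum => i.
rewrite mulr_sumr; apply: int_span_sum => j.
have -> : ratr (t i) * zeta ^+ i * (ratr (u j) * zeta ^+ j) = ratr (t i * u j) * zeta ^+ (i + j).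
  by rewrite -[ratr (_ * _)]phiE rmorphM !phiE exprD; ring.
apply: int_span_mono; rewrite -phiE rmorphM !phiE pabsM.
by rewrite mulr_ile1 ?pabs_ge0.
Qed.

Lemma int_span_ratr a : v (ratr a) <= 1 -> int_span (ratr a).
Proof. by move=> a1; have := @int_span_mono a 0 a1; rewrite expr0 mulr1. Qed.

Lemma int_span_nat n : int_span n%:R.
Proof.
have -> : n%:R = ratr n%:R :> K by rewrite -phiE rmorph_nat.
by apply: int_span_ratr; rewrite -phiE rmorph_nat pabs_nat_le1.
Qed.

Lemma int_span_natV n : coprime p n -> int_span n%:R^-1.
Proof.
move=> pn; have E : n%:R^-1 = ratr n%:R^-1 :> K by rewrite -phiE fmorphV rmorph_nat.
by rewrite E; apply: int_span_ratr; rewrite -E pabsV pabs_nat_coprime// invr1.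
Qed.

Lemma int_span_N x : int_span x -> int_span (- x).
Proof.
move=> xx; rewrite -mulN1r; apply: int_span_M => //.
have E : -1 = ratr (-1) :> K by rewrite -phiE rmorphN1.
by rewrite E; apply: int_span_ratr; rewrite -E pabsN pabs1.
Qed.

Lemma int_span_X x n : int_span x -> int_span (x ^+ n).
Proof.
move=> xx; elim: n => [|n IH]; first exact: (int_span_nat 1).
by rewrite exprS; exact: int_span_M.
Qed.

Lemma int_span_root x : x ^+ c = 1 -> int_span x.
Proof.
move=> /(prim_rootP zeta_prim)[i ->]; apply: int_span_X.
have -> : zeta = ratr 1 * zeta ^+ 1 by rewrite -phiE rmorph1 mul1r expr1.
by apply: int_span_mono; rewrite -phiE rmorph1 pabs1.
Qed.

Lemma int_span_geom_moment z l : z ^+ c = 1 -> z != 1 -> int_span (geom_moment z l).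
Proof.
move=> zc z1; elim/ltn_ind: l => l IH.
have z0 : z != 0 by rewrite -(@pabs_gt0 _ _ K) (pabs_root pc zc).
have inv := root_inv p_pr pc zc z1.
rewrite -[geom_moment z l]mul1r -inv mulrAC mulrC (geom_moment_rec l z0 z1).
apply: int_span_M.
  apply: int_span_M.
    by apply/int_span_N/int_span_natV; rewrite prime_coprime.
  apply: int_span_sum => k; apply: int_span_M; first exact: int_span_nat.
  exact/int_span_X/int_span_root.
apply: int_span_D; first exact: int_span_nat.
apply: int_span_M; first exact: int_span_root.
apply: int_span_sum => i; apply: int_span_M; first exact: int_span_nat.
exact: IH.
Qed.

(** Q_p(mu_c) is an intersection of fields, each of which contains Q_p and the
    powers of zeta but need not visibly be closed; hence the series is summed
    coordinate by coordinate with respect to 1, zeta, .., zeta^(c-1). *)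
Lemma Qp_mu_lim (T : nat -> K) S : (forall l, exists2 d, int_span d & T l = p%:R ^+ l * d) ->
  (forall L, v (S - \sum_(l < L) T l) <= (p%:R ^+ L)^-1) -> Qp_mu c S.
Proof.
move=> HT HS.
have /choice[t Ht] : forall l, exists t : nat -> rat, (forall k, v (ratr (t k)) <= 1) /\
    T l = p%:R ^+ l * \sum_(k < c) ratr (t k) * zeta ^+ k.
  by move=> l; have [d [t [t1 ->]] ->] := HT l; exists t.
pose a k l : K := p%:R ^+ l * ratr (t l k).
have /choice[tau Htau] : forall k, exists tau, forall L, v (tau - \sum_(l < L) a k l) <= (p%:R ^+ L)^-1.
  move=> k; apply: padic_series => l; rewrite pabsM pabs_natX ler_piMr ?expVp_ge0//.
  by have [h _] := Ht l; exact: h.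
have -> : S = \sum_(k < c) tau k * zeta ^+ k.
  apply: (@abs_cvg_unique (fun L => \sum_(l < L) T l)); apply/abs_cvgP => e e0;
    have [N HN] := expVp_cvg0 p_pr e0; exists N => L /HN; apply: le_lt_trans;
    rewrite pabs_distC; first exact: HS.
  have -> : \sum_(l < L) T l = \sum_(k < c) (\sum_(l < L) a k l) * zeta ^+ k.
    under eq_bigr do rewrite (proj2 (Ht _)) mulr_sumr.
    rewrite exchange_big; apply: eq_bigr => k _; rewrite mulr_suml.
    by apply: eq_bigr => l _; rewrite mulrA.
  rewrite -sumrB; apply: pabs_sum_le => [|k _ _]; first exact: expVp_ge0.
  have zk : (zeta ^+ k) ^+ c = 1 by rewrite exprAC (prim_expr_order zeta_prim) expr1n.
  by rewrite -mulrBl pabsM (pabs_root pc zk) mulr1.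
apply: Qp_mu_sum => k; apply: Qp_mu_mul; last first.
  by apply: Qp_mu_root; rewrite exprAC (prim_expr_order zeta_prim) expr1n.
apply: Qp_mu_Qp => e e0; have [N HN] := expVp_cvg0 p_pr e0.
exists (\sum_(l < N) a k l); last by apply: le_lt_trans (Htau k N) (HN N (leqnn _)).
exists (\sum_(l < N) p%:R ^+ l * t l k) => //.
rewrite -phiE rmorph_sum; apply: eq_bigr => l _.
by rewrite rmorphM rmorphXn rmorph_nat phiE.
Qed.

(** The argument is taken in the form x^p, so that the preimage under
    Frobenius is explicit. *)
Lemma Frob_inv_frakH (F : K -> K) n x : is_Frob c F -> x ^+ c = 1 ->
  Frob_inv c F (frakH n (x ^+ p)^-1) = p%:R ^+ n * \sum_(1 <= m < p) x ^+ m / m%:R ^+ n.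
Proof.
move=> [[_ Finj _] FD FM FQ Fmu] xc.
pose q m : rat := p%:R ^+ n / m%:R ^+ n.
have qE m : p%:R ^+ n / m%:R ^+ n = ratr (q m) :> K.
  by rewrite -phiE fmorph_div !rmorphXn !rmorph_nat.
have -> : p%:R ^+ n * \sum_(1 <= m < p) x ^+ m / m%:R ^+ n =
    \sum_(1 <= m < p) ratr (q m) * x ^+ m.
  by rewrite mulr_sumr; apply: eq_bigr => m _; rewrite -qE mulrCA mulrC.
have Qx m : Qp_mu c (x ^+ m) by apply: Qp_mu_root; rewrite exprAC xc expr1n.
have Qs : Qp_mu c (\sum_(1 <= m < p) ratr (q m) * x ^+ m).
  by apply: Qp_mu_sum => m; apply: Qp_mu_mul; [exact: Qp_mu_ratr|exact: Qx].
suff -> : frakH n (x ^+ p)^-1 = F (\sum_(1 <= m < p) ratr (q m) * x ^+ m).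
  by rewrite /Frob_inv pinvKV// ?inE.
rewrite /frakH /harmonic_val invrK mulr_sumr.
have F0 : F 0 = 0 by apply: FQ; have := Qp_ratr 0; rewrite -phiE rmorph0.
have Fsum (r : seq nat) : F (\sum_(m <- r) ratr (q m) * x ^+ m) =
    \sum_(m <- r) ratr (q m) * (x ^+ p) ^+ m.
  elim: r => [|m r IH]; first by rewrite !big_nil.
  have Qm : Qp_mu c (ratr (q m) * x ^+ m).
    by apply: Qp_mu_mul; [exact: Qp_mu_ratr|exact: Qx].
  have Qr : Qp_mu c (\sum_(m <- r) ratr (q m) * x ^+ m).
    by apply: Qp_mu_sum => j; apply: Qp_mu_mul; [exact: Qp_mu_ratr|exact: Qx].
  rewrite !big_cons FD ?inE// IH FM ?inE//; last exact: Qp_mu_ratr.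
  rewrite (FQ _ (Qp_ratr _)) Fmu; last by rewrite exprAC xc expr1n.
  by rewrite exprAC.
by rewrite Fsum; apply: eq_bigr => m _; rewrite -qE mulrCA mulrC.
Qed.

(** As p is invertible modulo c, x -> x^p is invertible on mu_c. *)
Lemma set_bij_pow : set_bij (@mu_minus1 K c) (@mu_minus1 K c) (fun x => x ^+ p).
Proof.
have cpc : coprime p c by rewrite prime_coprime.
have [u w E _] := egcdnP c (prime_gt0 p_pr); rewrite (eqP cpc) in E.
have up x : x ^+ c = 1 -> (x ^+ p) ^+ u = x.
  by move=> xc; rewrite -exprM mulnC E exprD expr1 mulnC exprM xc expr1n mul1r.
split.
- move=> x [xc /eqP x1]; split; first by rewrite exprAC xc expr1n.
  exact/eqP/(root_powp_neq1 pc xc x1).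
- move=> x y; rewrite !inE => -[xc _] [yc _] /= xy.
  by rewrite -(up x xc) xy up.
move=> x [xc /eqP x1]; exists (x ^+ u); last by rewrite /= exprAC up.
split; first by rewrite exprAC xc expr1n.
by move=> xu; move/eqP: x1; apply; rewrite -(up x xc) exprAC xu expr1n.
Qed.

Lemma set_bij_iota : set_bij (@mu_minus1 algC c) (@mu_minus1 K c) iota.
Proof.
split.
- move=> x [xc x1]; split; first by rewrite -rmorphXn xc rmorph1.
  by move=> /eqP; rewrite fmorph_eq1 => /eqP.
- by move=> x y _ _ /fmorph_inj.
move=> x [xc x1]; have [w wc xw] := root_iota xc; exists w => //; split=> // w1.
by apply: x1; rewrite xw w1 rmorph1.
Qed.


Lemma mu_minus1_seq : exists s : seq K, [/\ uniq s, @mu_minus1 K c = [set` s] &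
  forall x, x \in s -> x ^+ c = 1 /\ x != 1].
Proof.
pose s := [seq x <- undup [seq zeta ^+ i | i <- seq.iota 0 c] | x != 1].
have sP x : (x \in s) <-> mu_minus1 c x.
  rewrite mem_filter mem_undup; split.
    move=> /andP[/eqP x1 /mapP[i _ xE]]; split => //.
    by rewrite xE exprAC (prim_expr_order zeta_prim) expr1n.
  move=> [/(prim_rootP zeta_prim)[i xE] /eqP x1]; rewrite x1 /=.
  by apply/mapP; exists (i : nat) => //; rewrite mem_iota add0n /=.
exists s; split.
- exact/filter_uniq/undup_uniq.
- by apply/seteqP; split => x /sP.
- by move=> x /sP[xc /eqP].
Qed.

End Roots.
End Padic.

(** * The p-adic L-function as a series *)

Section Padic.
Variables (R : realType) (p : nat) (K : Cp_field R p).
Hypothesis p_pr : prime p.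
Implicit Types (x y z : K) (m n l N L k a b : nat).
Local Notation v := (@pabs R p K).

Let p_gt0 : (0 < p)%N := prime_gt0 p_pr.

(** The polynomial X^(p-1) - 1 splits, and its value at a is small by Fermat,
    so one of its roots is close to a. *)
Lemma teichmuller_spec a : coprime p a ->
  v (a%:R - teichmuller a%:R : K) < 1 /\ teichmuller a%:R != 0 :> K.
Proof.
move=> pa.
have p1 : (0 < p.-1)%N by rewrite -subn1 subn_gt0 prime_gt1.
have small : v (a%:R ^+ p.-1 - 1) < 1.
  have ap : (a <= a ^ p)%N by rewrite -{1}[a]expn1; case: a pa => [|a] pa; rewrite ?exp0n// leq_pexp2l.
  have /dvdnP[q qE] : (p %| a ^ p - a)%N by rewrite -eqn_mod_dvd//; apply/eqP/fermat_little.
  rewrite -[ltLHS]mul1r -[X in X * _](pabs_nat_coprime K p_pr pa) -pabsM mulrBr mulr1 -exprS prednK//.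
  rewrite -natrX -(subnK ap) natrD addrK qE natrM pabsM.
  apply: (@le_lt_trans _ _ (v p%:R)); first by rewrite ler_piMl ?pabs_ge0 ?pabs_nat_le1.
  by rewrite pabs_p invf_lt1 ?ltr0n// ltr1n prime_gt1.
have [r rE] := closed_field_poly_normal ('X^(p.-1) - 1 : {poly K}).
rewrite lead_coefXnsubC// scale1r in rE.
have [w wr w1] : exists2 w, w \in r & v (a%:R - w) < 1.
  apply: contrapT => nw; move: small; apply/negP; rewrite -leNgt.
  have -> : a%:R ^+ p.-1 - 1 = \prod_(z <- r) (a%:R - z).
    have := congr1 (fun q => q.[a%:R]) rE; rewrite !hornerE => ->.
    by rewrite horner_prod; apply: eq_bigr => z _; rewrite !hornerE.
  have {}nw z : z \in r -> 1 <= v (a%:R - z).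
    by move=> zr; rewrite leNgt; apply/negP => h; apply: nw; exists z.
  elim: r {rE} nw => [|z r IH] nw; first by rewrite big_nil pabs1.
  rewrite big_cons pabsM -[leLHS]mulr1; apply: ler_pM => //; first by rewrite nw ?mem_head.
  by apply: IH => z' zr; apply: nw; rewrite in_cons zr orbT.
have wp : w ^+ p.-1 = 1.
  have : root ('X^(p.-1) - 1) w by rewrite rE root_prod_XsubC.
  by rewrite /root !hornerE subr_eq0 => /eqP.
have cop : coprime p.-1 p by have := coprimenS p.-1; rewrite prednK// coprime_sym.
rewrite /teichmuller; case: xgetP => [u _ [[m [m0 _ um]] hu]|/(_ w)].
  by split=> //; apply/eqP => u0; move/eqP: um; rewrite u0 expr0n gtn_eqF// eq_sym oner_eq0.
by case; split=> //; exists p.-1.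
Qed.

Definition unit_inv_pow k a : K := if (p %| a)%N then 0 else a%:R ^- k.+1.

(** On units, the integrand is simply x^(-n), whichever root of unity
    represents omega(x). *)
Lemma integrand_nat k a :
  \1_(Zp_units : set K) a%:R *
    (angle a%:R ^ (- k.+1%:Z) * teichmuller a%:R ^ (- k.+1%:Z)) = unit_inv_pow k a.
Proof.
rewrite indicE /unit_inv_pow; case: ifPn => pa.
  rewrite memNset ?mul0r// => -[_] va; move/dvdnP: pa va => [q ->].
  rewrite natrM pabsM => va.
  have vp : v p%:R < 1 by rewrite pabs_p invf_lt1 ?ltr0n// ltr1n prime_gt1.
  suff : v q%:R * v p%:R < 1 by rewrite va ltxx.
  by apply: le_lt_trans vp; rewrite ler_piMl ?pabs_ge0 ?pabs_nat_le1.
have cpa : coprime p a by rewrite prime_coprime.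
rewrite mem_set ?mul1r; last first.
  split; last exact: pabs_nat_coprime.
  by move=> e e0; exists a%:R; [exists a%:R => //; exact: ratr_nat|rewrite subrr pabs0].
have [_ t0] := teichmuller_spec cpa.
by rewrite -expfzMl /angle divfK// -exprnN.
Qed.

Section Roots.
Variable c : nat.
Hypotheses (pc : ~~ (p %| c)%N) (c_gt0 : (0 < c)%N).
Variable s : seq K.
Hypotheses (s_uniq : uniq s) (sE : @mu_minus1 K c = [set` s]).
Hypothesis sP : forall x, x \in s -> x ^+ c = 1 /\ x != 1.
Variable k : nat.

Definition harmonic_sum x l : K := \sum_(1 <= m < p) x ^+ m / m%:R ^+ (k.+1 + l).

Definition series_term l : K := \sum_(x <- s)
  negbin K k l * geom_moment (x ^+ p) l * (p%:R ^+ (k.+1 + l) * harmonic_sum x l).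

Lemma sum_unit_inv_pow (g : nat -> K) N :
  \sum_(a < p ^ N.+1) unit_inv_pow k a * g a =
  \sum_(b < p ^ N) \sum_(1 <= m < p) (m + b * p)%:R ^- k.+1 * g (m + b * p)%N.
Proof.
rewrite -(big_mkord xpredT (fun a => unit_inv_pow k a * g a)) expnSr big_nat_mul big_mkord.
apply: eq_bigr => b _; rewrite mulSn -{1}[(b * p)%N]add0n big_addn addnK.
rewrite big_ltn// add0n /unit_inv_pow dvdn_mull//= mul0r add0r.
apply: eq_big_nat => m /andP[m1 mp].
by rewrite dvdn_addl ?dvdn_mull// gtnNdvd.
Qed.

Let vp : v p%:R < 1.
Proof. by rewrite pabs_p invf_lt1 ?ltr0n// ltr1n prime_gt1. Qed.

(** The expansion of (m + p b)^(-n) is cut at l < L, with an error of p^(-L),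
    and the sums over b are replaced by their limits, with an error of p^(-N). *)
Lemma term_estimate x N L : x ^+ c = 1 -> x != 1 ->
  v (p%:R ^+ k.+1 * \sum_(a < p ^ N.+1) unit_inv_pow k a * (x ^+ a / (1 - x ^+ (p ^ N.+1))) -
     \sum_(l < L) negbin K k l * geom_moment (x ^+ p) l * (p%:R ^+ (k.+1 + l) * harmonic_sum x l))
  <= Num.max (p%:R ^+ L)^-1 (p%:R ^+ N)^-1.
Proof.
move=> xc x1.
have vx : v x = 1 := pabs_root pc xc.
have pcp : coprime p c by rewrite prime_coprime.
pose z := x ^+ p.
have zc : z ^+ c = 1 by rewrite /z exprAC xc expr1n.
have z1 : z != 1 by exact: (root_powp_neq1 pc xc x1 pcp).
have dE : 1 - x ^+ (p ^ N.+1) = 1 - z ^+ (p ^ N) by rewrite /z -exprM -expnS.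
have zNc : (z ^+ (p ^ N)) ^+ c = 1 by rewrite exprAC zc expr1n.
have zN1 : z ^+ (p ^ N) != 1 by apply: (root_powp_neq1 pc zc z1); rewrite coprimeXl.
have v1zN := pabs_sub_root p_pr pc zNc zN1.
pose Y := \sum_(l < L) negbin K k l * moment_approx z l N * (p%:R ^+ (k.+1 + l) * harmonic_sum x l).
rewrite -[X in v X](subrK (Y - \sum_(l < L)
  negbin K k l * geom_moment z l * (p%:R ^+ (k.+1 + l) * harmonic_sum x l))).
have -> : forall A B D : K, A - B - (D - B) + (D - B) = (A - D) + (D - B).
  by move=> A B D; ring.
have vX j : v (x ^+ j) = 1 by rewrite pabsX vx expr1n.
have vm m : (1 <= m < p)%N -> v m%:R = 1.
  by move=> /andP[m1 mp]; apply: pabs_nat_coprime => //; rewrite prime_coprime// gtnNdvd.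
have vpow j : v (p%:R ^+ j) <= 1 by rewrite pabsX exprn_ile1 ?pabs_ge0// ltW.
rewrite dE (sum_unit_inv_pow (fun a => x ^+ a / (1 - z ^+ (p ^ N)))).
apply: le_trans (pabsD _ _) _; rewrite ge_max; apply/andP; split.
  rewrite le_max; apply/orP; left.
  (* the truncated expansion of (m + b p)^(-k-1) in powers of b p / m *)
  have -> : Y = p%:R ^+ k.+1 * \sum_(b < p ^ N) \sum_(1 <= m < p)
      (m%:R ^- k.+1 * \sum_(l < L) negbin K k l * (b%:R * p%:R / m%:R) ^+ l) *
      (x ^+ (m + b * p) / (1 - z ^+ (p ^ N))).
    rewrite /Y /moment_approx /harmonic_sum.
    under [in RHS]eq_bigr do under eq_bigr do rewrite mulr_sumr mulr_suml.
    under [in RHS]eq_bigr do rewrite exchange_big /=.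
    rewrite [in RHS]exchange_big /= mulr_sumr; apply: eq_bigr => l _.
    rewrite [in LHS]mulr_suml [in LHS]mulr_sumr [in LHS]mulr_suml [in RHS]mulr_sumr.
    apply: eq_bigr => b _.
    rewrite !mulr_sumr; apply: eq_bigr => m _.
    by rewrite !exprMn !exprVn !exprD (mulnC b) exprM -/z !invfM; ring.
  rewrite -mulrBr pabsM -[leRHS]mul1r; apply: ler_pM; rewrite ?pabs_ge0 ?vpow//.
  rewrite -sumrB; apply: pabs_sum_le => [|b _ _]; first exact: expVp_ge0.
  rewrite -sumrB big_seq_cond; apply: pabs_sum_le => [|m _ /andP[+ _]]; first exact: expVp_ge0.
  rewrite mem_index_iota => mp.
  rewrite -mulrBl pabsM (_ : v (_ / _) = 1) ?mulr1; last first.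
    by rewrite pabsM pabsV vX v1zN invr1 mulr1.
  have m0 : m%:R != 0 :> K by rewrite -(@pabs_gt0 _ _ K) (vm _ mp) ltr01.
  pose t : K := b%:R * p%:R / m%:R.
  have tE : (m + b * p)%:R = m%:R * (1 + t) by rewrite /t natrD natrM; field.
  have vt : v t <= p%:R^-1.
    by rewrite /t !pabsM pabsV (vm _ mp) invr1 mulr1 pabs_p ler_piMl ?invr_ge0 ?pabs_nat_le1.
  have vt1 : v t < 1 by apply: le_lt_trans vt _; rewrite -(@pabs_p _ _ K).
  have v1t : v (1 + t) = 1.
    have := congr1 v tE; rewrite pabsM (vm _ mp) mul1r => <-.
    apply: pabs_nat_coprime => //; rewrite prime_coprime// dvdn_addl ?dvdn_mull//.
    by case/andP: mp => m1 mp; rewrite gtnNdvd.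
  rewrite tE exprMn invfM -mulrBr pabsM pabsV pabsX (vm _ mp) expr1n invr1 mul1r.
  apply: le_trans (negbinom_approx k L v1t (ltW vt1)) _.
  by rewrite -exprVn lerXn2r// nnegrE ?pabs_ge0 ?invr_ge0.
rewrite le_max; apply/orP; right; rewrite /Y -sumrB; apply: pabs_sum_le => [|l _ _]; first exact: expVp_ge0.
rewrite -mulrBl -mulrBr pabsM (pabsM (negbin K k l)) (pabsM (p%:R ^+ (k.+1 + l))).
rewrite -[leRHS]mulr1; apply: ler_pM; rewrite ?mulr_ge0 ?pabs_ge0//.
  rewrite -[leRHS]mul1r; apply: ler_pM; rewrite ?pabs_ge0 ?negbin_le1//.
  by have [] := moment_approx_bound p_pr pc l N zc z1.
rewrite mulr_ile1 ?pabs_ge0 ?vpow// /harmonic_sum big_seq_cond.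
apply: pabs_sum_le => // m _ /andP[+ _]; rewrite mem_index_iota => mp.
by rewrite pabsM pabsV pabsX (pabsX m%:R) vx (vm _ mp) !expr1n invr1 mulr1.
Qed.

Lemma sum_mu_minus1 (F : K -> K) : \sum_(x \in (mu_minus1 c : set K)) F x = \sum_(x <- s) F x.
Proof. by rewrite sE (fsbig_seq _ _ s_uniq). Qed.

(** The estimates at levels N and L show both that the integral exists and
    that it is the sum of the series, with a bound that does not involve N. *)
Lemma Lp1_series L :
  v (p%:R ^+ k.+1 * Lp1 k.+1%:Z (- k.+1%:Z) c - \sum_(l < L) series_term l) <= (p%:R ^+ L)^-1.
Proof.
pose I N := \sum_(a < p ^ N) unit_inv_pow k a * mc_tilde c N a : K.
have est N M : v (p%:R ^+ k.+1 * I N.+1 - \sum_(l < M) series_term l) <= Num.max (p%:R ^+ M)^-1 (p%:R ^+ N)^-1.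
  have -> : p%:R ^+ k.+1 * I N.+1 - \sum_(l < M) series_term l =
    \sum_(x <- s) (p%:R ^+ k.+1 * \sum_(a < p ^ N.+1) unit_inv_pow k a * (x ^+ a / (1 - x ^+ (p ^ N.+1))) -
     \sum_(l < M) negbin K k l * geom_moment (x ^+ p) l * (p%:R ^+ (k.+1 + l) * harmonic_sum x l)).
    rewrite sumrB; congr (_ - _); last by rewrite exchange_big.
    rewrite -mulr_sumr; congr (_ * _); rewrite exchange_big; apply: eq_bigr => a _.
    by rewrite /mc_tilde sum_mu_minus1 mulr_sumr.
  rewrite big_seq_cond; apply: pabs_sum_le => [|x _ /andP[/sP[xc x1] _]].
    by rewrite le_max expVp_ge0.
  exact: term_estimate.
have pk0 : p%:R ^+ k.+1 != 0 :> K by rewrite expf_neq0// natr_neq0.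
have [S HS] : exists S, abs_cvg v I S.
  apply: Cp_complete => e e0.
  have vpk : 0 < v (p%:R ^+ k.+1) by rewrite pabs_gt0.
  have [N HN] := expVp_cvg0 p_pr (mulr_gt0 vpk e0); exists N.+1 => -[//|i] [//|j] Ni Nj.
  rewrite -(ltr_pM2l vpk) -pabsM mulrBr; apply: le_lt_trans (HN N (leqnn _)).
  have -> : p%:R ^+ k.+1 * I i.+1 - p%:R ^+ k.+1 * I j.+1 =
    (p%:R ^+ k.+1 * I i.+1 - \sum_(l < N) series_term l) -
    (p%:R ^+ k.+1 * I j.+1 - \sum_(l < N) series_term l) by ring.
  by apply: pabsB_le; apply: le_trans (est _ _) _; rewrite ge_max lexx expVp_le.
have -> : Lp1 k.+1%:Z (- k.+1%:Z) c = S.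
  rewrite /Lp1 /padic_int; have IE : (fun N => \sum_(a < p ^ N)
    \1_(Zp_units : set K) a%:R * (angle a%:R ^ (- k.+1%:Z) * teichmuller a%:R ^ (- k.+1%:Z)) * mc_tilde c N a) = I.
    by apply/funext => N; apply: eq_bigr => a _; rewrite integrand_nat.
  case: xgetP => [S' _|/(_ S)]; rewrite /= IE; last by case.
  by move=> HS'; exact: abs_cvg_unique HS' HS.
move/abs_cvgP : HS => HS.
have e0 : 0 < (p%:R ^+ L)^-1 :> R by rewrite invr_gt0 exprn_gt0// ltr0n.
have [N HN] := HS _ e0; pose M := maxn N L.
have -> : p%:R ^+ k.+1 * S - \sum_(l < L) series_term l =
  (p%:R ^+ k.+1 * I M.+1 - \sum_(l < L) series_term l) - p%:R ^+ k.+1 * (I M.+1 - S) by ring.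
apply: pabsB_le.
  by apply: le_trans (est _ _) _; rewrite ge_max lexx expVp_le// leq_maxr.
rewrite pabsM -[leRHS]mul1r; apply: ler_pM; rewrite ?pabs_ge0//.
  by rewrite pabsX exprn_ile1 ?pabs_ge0// ltW.
by apply/ltW/HN; rewrite (leq_trans (leq_maxl N L)).
Qed.

Variable iota : {rmorphism algC -> K}.

Lemma Lp1_Qp_mu : Qp_mu c (p%:R ^+ k.+1 * Lp1 k.+1%:Z (- k.+1%:Z) c : K).
Proof.
have pcp : coprime p c by rewrite prime_coprime.
apply: (@Qp_mu_lim _ _ _ p_pr _ iota pc c_gt0 series_term _ _ Lp1_series).
move=> l.
exists (\sum_(x <- s) negbin K k l * geom_moment (x ^+ p) l * (p%:R ^+ k.+1 * harmonic_sum x l)).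
  rewrite big_seq_cond.
  apply: (big_ind (int_span iota c_gt0)); [exact: int_span0|exact: int_span_D|].
  move=> x /andP[/sP[xc x1] _].
  have zc : (x ^+ p) ^+ c = 1 by rewrite exprAC xc expr1n.
  have z1 : x ^+ p != 1 by exact: (root_powp_neq1 pc xc x1 pcp).
  apply: int_span_M; first apply: int_span_M.
  - apply: int_span_M; last exact: int_span_nat.
    by apply: int_span_X; apply: int_span_N; exact: (int_span_nat _ _ 1).
  - exact: int_span_geom_moment.
  - apply: int_span_M; first by apply: int_span_X; exact: int_span_nat.
    rewrite /harmonic_sum big_seq_cond.
    apply: (big_ind (int_span iota c_gt0)); [exact: int_span0|exact: int_span_D|].
    move=> m /andP[+ _]; rewrite mem_index_iota => /andP[m1 mp].
    apply: int_span_M; first by apply: int_span_X; exact: int_span_root.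
    rewrite -exprVn; apply: int_span_X; apply: int_span_natV => //.
    by rewrite prime_coprime// gtnNdvd.
rewrite /series_term mulr_sumr.
by apply: eq_bigr => x _; rewrite exprD; ring.
Qed.

(** The substitution eps = x^p turns the inverse Frobenius into a harmonic sum
    in x. *)
Lemma series_termE (iotaC : {rmorphism algC -> R[i]}) (F : K -> K) l : is_Frob c F ->
  (forall w : algC, w ^+ c = 1 -> w != 1 ->
    alg_of iotaC (zeta1 (iotaC w) (- l%:R)) = polylog_neg w l) ->
  \sum_(eps \in (mu_minus1 c : set algC))
         iota (gbinom (- k.+1%:R) l * (-1) ^+ (1 + l) *
                 alg_of iotaC (zeta1 (iotaC eps^-1) (- l%:R))) *
         Frob_inv c F (frakH (k.+1 + l) (iota eps^-1)) = series_term l.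
Proof.
move=> FF zetaE.
pose G x : K := negbin K k l * geom_moment x l * Frob_inv c F (frakH (k.+1 + l) x^-1).
transitivity (\sum_(eps \in (mu_minus1 c : set algC)) G (iota eps)).
  apply: eq_fsbigr => eps; rewrite inE => -[ec /eqP e1].
  rewrite zetaE; last 2 first.
  - by rewrite exprVn ec invr1.
  - by rewrite invr_eq1.
  rewrite /G fmorphV; congr (_ * _).
  have gE : iota (gbinom (- k.+1%:R) l) = negbin K k l.
    rewrite -(gbinomE K p_pr) /gbinom fmorph_div rmorph_prod rmorph_nat.
    by congr (_ / _); apply: eq_bigr => i _; rewrite rmorphB rmorphN !rmorph_nat.
  rewrite [iota (_ * polylog_neg _ _)]rmorphM [iota (gbinom _ _ * _)]rmorphM gE.
  by rewrite polylog_neg_rmorph fmorphV rmorphXn rmorphN1 /geom_moment mulrA.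
rewrite -(reindex_fsbig iota _ _ G (set_bij_iota iota c_gt0)).
rewrite (reindex_fsbig _ _ _ G (set_bij_pow K p_pr pc)).
rewrite sum_mu_minus1 /series_term [LHS]big_seq [RHS]big_seq.
apply: eq_bigr => x /sP[xc x1]; rewrite /G; congr (_ * _).
by rewrite (Frob_inv_frakH iota).
Qed.

End Roots.
End Padic.

(** * Comparison of the two sides *)

Theorem corollary3p17 (R : realType) (c : nat) (hc : (2 <= c)%N)
    (K : forall q : primes_of c, Cp_field R (val q))
    (iotaC : {rmorphism algC -> R[i]})
    (iota : forall q : primes_of c, {rmorphism algC -> K q})
    (Frob : forall q : primes_of c, K q -> K q)
    (hFrob : forall q : primes_of c, is_Frob c (Frob q))
    (n : nat) (hn : (1 <= n)%N) :
  (forall q : primes_of c,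
     Qp_mu c ((val q)%:R ^+ n * Lp1 n%:Z (- n%:Z) c : K q)) /\
  uniform_cvg
    (fun (L : nat) (q : primes_of c) =>
       \sum_(l < L) \sum_(eps \in (mu_minus1 c : set algC))
         iota q (gbinom (- n%:R) l * (-1) ^+ (1 + l) *
                 alg_of iotaC (zeta1 (iotaC eps^-1) (- l%:R))) *
         Frob_inv c (Frob q) (frakH (n + l) (iota q eps^-1)))
    (fun q : primes_of c => (val q)%:R ^+ n * Lp1 n%:Z (- n%:Z) c : K q).
Proof.
case: n hn => // k _.
have c0 : (0 < c)%N by apply: leq_trans hc.
have prq (q : primes_of c) : prime (val q) by case/andP: (valP q).
have pcq (q : primes_of c) : ~~ (val q %| c)%N by case/andP: (valP q).
have [s sP] : exists s : forall q : primes_of c, seq (K q), forall q,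
    [/\ uniq (s q), @mu_minus1 (K q) c = [set` s q] &
      forall x, x \in s q -> x ^+ c = 1 /\ x != 1].
  have h q := mu_minus1_seq (iota q) c0.
  by exists (fun q => projT1 (cid (h q))) => q; exact: projT2 (cid (h q)).
split=> [q|e e0].
  have [su sE sR] := sP q.
  exact: (Lp1_Qp_mu (prq q) (pcq q) c0 su sE sR k (iota q)).
(* uniformity in the prime q comes from q^(-L) <= 2^(-L) *)
have h2 : `|2^-1 : R| < 1 by rewrite ger0_norm ?invr_ge0// invf_lt1// ltr1n.
have /cvgrPdist_lt/(_ e e0)[N _ HN] := cvg_geometric 1 h2.
exists N => L /HN /= HL q; have [su sE sR] := sP q.
rewrite pabs_distC; under eq_bigr => l _.
  rewrite (@series_termE _ _ _ (prq q) _ (pcq q) c0 _ su sE sR k (iota q) iotaC _ _ (hFrob q)); last first.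
    by move=> w wc w1; exact: (alg_of_polylog _ _ c0 wc w1).
  over.
apply: le_lt_trans (Lp1_series (prq q) (pcq q) su sE sR k L) _.
apply: le_lt_trans HL; rewrite sub0r normrN mul1r exprVn; apply: le_trans (ler_norm _).
rewrite lef_pV2 ?posrE ?exprn_gt0 ?ltr0n ?prime_gt0//.
by rewrite lerXn2r ?nnegrE// ler_nat prime_gt1.
Qed.
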